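(* Let $N \geq 3$ be an integer, let $\alpha \geq 1$, $\beta \geq 1$ with $\alpha\beta > 1$, and let $p, q : \mathbf{R}^N \to [0,\infty)$ be continuous functions. Let $\tilde p$, $\tilde q$ be the functions associated with $p, q$ as defined in the context. Suppose that there are constants $L_1 > 0$, $L_2 > 0$, $r_0 > 1$ and real constants $\lambda, \nu, \mu, \xi$ such that $$\tilde p(r) \geq \frac{L_1}{r^\lambda \ln^\nu r}, \qquad \tilde q(r) \geq \frac{L_2}{r^\mu \ln^\xi r}, \qquad r \geq r_0 .$$ Suppose that at least one of the following conditions holds: (i) $2 - \mu + \beta(2-\lambda) > 0$; (ii) $2 - \lambda + \alpha(2-\mu) > 0$; (iii) $2 - \mu + \beta(2-\lambda) = 0$, $\lambda < 2$, $1 - \xi - \beta\nu > 0$; (iv) $2 - \lambda + \alpha(2-\mu) = 0$, $\mu < 2$, $1 - \nu - \alpha\xi > 0$; (v) $\lambda = 2$, $\mu = 2$, $1 - \xi + \beta(1-\nu) > 0$; (vi) $\lambda = 2$, $\mu = 2$, $1 - \nu + \alpha(1-\xi) > 0$. Then the system $$\Delta u = p(x)\, v^\alpha, \qquad \Delta v = q(x)\, u^\beta, \qquad x \in \mathbf{R}^N,$$ has no nontrivial nonnegative entire solutions.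
   Context: An entire solution of the system is a pair $(u,v) \in C^2(\mathbf{R}^N)\times C^2(\mathbf{R}^N)$ satisfying both equations at every point of $\mathbf{R}^N$. It is nonnegative if $u \ge 0$ and $v \geq 0$ on $\mathbf{R}^N$, and nontrivial if $(u,v)$ is not identically $(0,0)$. Let $\omega_N$ be the surface area of the unit sphere in $\mathbf{R}^N$. For $r > 0$, $$\tilde p(r) = \begin{cases} \left( \dfrac{1}{\omega_N r^{N-1}} \displaystyle\int_{|x|=r} p^{1/(1-\alpha)}(x)\, dS \right)^{1-\alpha}, & \alpha > 1, \\ \min_{|x|=r} p(x), & \alpha = 1, \end{cases}$$ $$\tilde q(r) = \begin{cases} \left( \dfrac{1}{\omega_N r^{N-1}} \displaystyle\int_{|x|=r} q^{1/(1-\beta)}(x)\, dS \right)^{1-\beta}, & \beta > 1, \\ \min_{|x|=r} q(x), & \beta = 1. \end{cases}$$ When $\alpha>1$ and $\int_{|x|=r} p^{1/(1-\alpha)}\,dS = \infty$ one sets $\tilde p(r) = 0$; when $\beta>1$ and $\int_{|x|=r} q^{1/(1-\beta)}\,dS = \infty$ one sets $\tilde q(r) = 0$. (A negative power of $0$ is read as $+\infty$ in the integrands.) *)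

(* Defs.v *)
From HB Require Import structures.
From mathcomp Require Import all_boot all_order all_algebra.
From mathcomp Require Import all_classical all_reals all_analysis.

Set Implicit Arguments.
Unset Strict Implicit.
Unset Printing Implicit Defensive.

Import Order.TTheory GRing.Theory Num.Theory.
Import numFieldNormedType.Exports.

Local Open Scope classical_set_scope.
Local Open Scope ring_scope.

(* The norm `|x| that the library puts on 'rV[R]_n is the sup norm; it only
   provides the topology. *)
Definition enorm (R : realType) (n : nat) (x : 'rV[R]_n) : R :=
  Num.sqrt (\sum_(i < n) x 0 i ^+ 2).

Definition esphere (R : realType) (n : nat) (r : R) : set 'rV[R]_n :=
  [set x | enorm x = r].

Definition partial (R : realType) (n : nat) (i : 'I_n)
    (f : 'rV[R]_n -> R) (x : 'rV[R]_n) : R :=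
  'D_(delta_mx 0 i : 'rV[R]_n) (f : 'rV[R]_n -> R^o) x.

Definition partially_derivable (R : realType) (n : nat) (i : 'I_n)
    (f : 'rV[R]_n -> R) : Prop :=
  forall x, derivable (f : 'rV[R]_n -> R^o) x (delta_mx 0 i : 'rV[R]_n).

Definition C1 (R : realType) (n : nat) (f : 'rV[R]_n -> R) : Prop :=
  continuous f /\
  forall i, partially_derivable i f /\ continuous (partial i f).

Definition C2 (R : realType) (n : nat) (f : 'rV[R]_n -> R) : Prop :=
  C1 f /\ forall i, C1 (partial i f).

Definition laplacian (R : realType) (n : nat) (f : 'rV[R]_n -> R)
    (x : 'rV[R]_n) : R :=
  \sum_(i < n) partial i (partial i f) x.

(* n-dimensional Lebesgue measure, as the n-fold product of the Lebesgue
   measure of the line, carried by n.-tuple R because the library equips this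
   type (and not 'rV[R]_n) with the product sigma-algebra. *)
Fixpoint lebesgue_rn (R : realType) (n : nat) :
    set (n.-tuple (measurableTypeR R)) -> \bar R :=
  match n with
  | 0 => \d_([tuple] : 0.-tuple (measurableTypeR R))
  | m.+1 => pushforward (@lebesgue_measure R \x @lebesgue_rn R m)%E
              (fun z => [tuple of z.1 :: z.2])
  end.

Definition vec_of_tuple (R : realType) (n : nat)
    (t : n.-tuple (measurableTypeR R)) : 'rV[R]_n :=
  \row_(i < n) (tnth t i : R).

(* Integral over |x| = r with respect to the surface measure dS.  The surface
   measure sigma of the unit sphere is the one of polar coordinates,
   sigma(A) = n * Leb {y | 0 < |y| <= 1, y / |y| \in A}
   (integrate s^(n-1) ds over ]0, 1]), and
   \int_(|x| = r) f dS = r^(n-1) \int f(r w) dsigma(w).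
   The value of the integrand at y = 0 is irrelevant. *)
Definition sphere_integral (R : realType) (n : nat) (r : R)
    (f : 'rV[R]_n -> \bar R) : \bar R :=
  ((r ^+ n.-1 * n%:R)%:E *
   \int[@lebesgue_rn R n]_(t in [set t | enorm (vec_of_tuple t) <= 1]%R)
     f ((r / enorm (vec_of_tuple t)) *: vec_of_tuple t))%E.

Definition sphere_area (R : realType) (n : nat) : R :=
  fine (sphere_integral 1 (fun _ : 'rV[R]_n => 1%E)).

(* x `^ e for x >= 0 and e < 0; the library sets 0 `^ e = 0 there. *)
Definition neg_powR (R : realType) (x e : R) : \bar R :=
  if x == 0 then +oo%E else (x `^ e)%:E.

(* The function p~ associated with p and the exponent a >= 1; q~ is obtained
   from q and b.  For continuous p the infimum over the (compact, nonempty)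
   sphere is a minimum. *)
Definition tilde (R : realType) (n : nat) (a : R) (p : 'rV[R]_n -> R)
    (r : R) : R :=
  if 1 < a then
    let I := sphere_integral r (fun x => neg_powR (p x) (1 - a)^-1) in
    if I == +oo%E then 0
    else ((sphere_area R n * r ^+ n.-1)^-1 * fine I) `^ (1 - a)
  else inf [set p x | x in @esphere R n r].

Definition entire_solution (R : realType) (n : nat) (a b : R)
    (p q u v : 'rV[R]_n -> R) : Prop :=
  [/\ C2 u, C2 v,
      forall x, laplacian u x = p x * v x `^ a &
      forall x, laplacian v x = q x * u x `^ b].

Definition nonneg_pair (R : realType) (n : nat) (u v : 'rV[R]_n -> R) : Prop :=
  (forall x, 0 <= u x) /\ (forall x, 0 <= v x).

Definition nontrivial_pair (R : realType) (n : nat)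
    (u v : 'rV[R]_n -> R) : Prop :=
  ~ (forall x, u x = 0 /\ v x = 0).

(* Main.v *)
Require Import Defs.
From HB Require Import structures.
From mathcomp Require Import all_boot all_order all_algebra.
From mathcomp Require Import all_classical all_reals all_analysis.
From mathcomp Require Import measurable_realfun ring lra.

Set Implicit Arguments.
Unset Strict Implicit.
Unset Printing Implicit Defensive.

Import Order.TTheory GRing.Theory Num.Theory.
Import numFieldNormedType.Exports.

Local Open Scope classical_set_scope.
Local Open Scope ring_scope.

(** Write [U] and [V] for the means of [u] and [v] over the sphere of radius
    [r]. Since [u] and [v] have nonnegative Laplacian, these means are
    nondecreasing in [r], and a nonnegative such function vanishes as soon as
    its means vanish for all large [r] ([log_mean_gt0_eventually]). It suffices
    to show that one of [U] and [V] vanishes for all large [r]; then so does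
    the other.

    The flux identity ([is_derive_sphere_int]) says that
    [N r^(N-1) U'(r)] is a fixed multiple of the integral of the Laplacian of
    [u] over the ball of radius [r], whose own derivative is given by the
    integral over the sphere ([is_derive_ball_int]).
    Because the surface measure is that of polar coordinates, both identities
    come from Lebesgue measure alone. The first one needs no divergence
    theorem for curved domains: testing the Laplacian against the weight
    [(r^2 - |x|^2)^2] gives an identity between ball integrals whose proof is
    the fundamental theorem of calculus on chords parallel to the axes
    ([green_ball]), and differentiating it twice in [r] yields the flux
    identity.

    Hoelder's inequality on each sphere ([tilde_mul_mean_le]) bounds the mean
    of [p v^alpha] from below by [tilde alpha p r * V(r)^alpha], so with
    [t = ln r] the flux identity becomes
      [U(t + h) - U(t) >= c h^2 e^((2 - lambda) t) t^(-nu) V(t)^alpha]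
    for [0 < h <= 1] ([log_mean_step], [log_mean_growth]), and likewise for
    [V]. Composing the two inequalities, [V] satisfies a superlinear inequality
    of exponent [alpha * beta > 1].

    Such an inequality is used on dyadically shrinking steps inside an interval
    [[t, t + d]]: the losses are only geometric, so [V] would blow up before
    [t + d] unless [C(t) V(t)^(alpha beta - 1)] stays below a fixed constant
    ([geometric_blow_up], [dyadic_blow_up]), a bound of Keller-Osserman type.
    Each of the conditions makes [C(t)] unbounded, which forces [V = 0]
    ([blow_up_vanish]): in case (i) [d = 2] and [C(t)] grows exponentially; in
    cases (iii) and (v) [d = t] and unit steps are first chained together
    ([chain_increments]), so that [C(t)] grows like a positive power of [t].
    Cases (ii), (iv) and (vi) exchange the two equations. *)

(** * Lebesgue measure on tuples and Fubini's theorem *)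

Section lebesgue_rn_measure.
Variable R : realType.
Local Notation E n := (n.-tuple (measurableTypeR R)).

Definition tcons n (z : measurableTypeR R * E n) : E n.+1 := [tuple of z.1 :: z.2].

Lemma measurable_tcons n : measurable_fun [set: measurableTypeR R * E n] (@tcons n).
Proof. by apply: measurable_cons => //. Qed.

Definition box n (c : E n) (d : R) : set (E n) :=
  [set t | forall i, `|tnth t i - tnth c i| < d].

(** The recursive structure of boxes, matching that of the measure. *)
Lemma box_tcons n (c : E n.+1) d :
  @tcons n @^-1` box c d =
  `]thead c - d, thead c + d[%classic `*` box [tuple of behead c] d.
Proof.
rewrite [c in LHS]tuple_eta; apply/seteqP; split=> -[x t] /=.
  move=> H; split=> [|i].
    by have := H ord0; rewrite !tnth0 /= ltr_distl in_itv.
  by have := H (lift ord0 i); rewrite /tcons !tnthS.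
move=> [xd td] i; case: (unliftP ord0 i) => [j ->|->].
  by rewrite /tcons !tnthS; exact: td.
by rewrite !tnth0 /= ltr_distl; move: xd; rewrite in_itv.
Qed.

Lemma measurable_box n (c : E n) d : measurable (box c d).
Proof.
have -> : box c d = \bigcap_(i in [set: 'I_n])
    ((@tnth _ (measurableTypeR R) ^~ i) @^-1` `]tnth c i - d, tnth c i + d[).
  apply/seteqP; split=> [t H i _|t H i] /=.
    by rewrite in_itv /= -ltr_distl; exact: H.
  by have := H i I; rewrite /= in_itv /= -ltr_distl.
apply: fin_bigcap_measurable => // i _.
rewrite -[X in measurable X]setTI; exact: measurable_tnth.
Qed.

(** The measure axioms are carried through the recursion together with the
    volume of boxes, because boxes provide the exhaustion needed for
    sigma-finiteness, without which the next product need not be a measure. *)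
Lemma lebesgue_rn_sigma_finite_measure n :
  {mu : {sigma_finite_measure set (E n) -> \bar R} |
    @lebesgue_rn R n = mu :> (set (E n) -> \bar R) &
    forall c d, 0 < d -> mu (box c d) = ((d *+ 2) ^+ n)%:E}.
Proof.
elim: n => [|n [mu IH mubox]].
  exists (\d_([tuple] : E 0)) => [|c d d0]; first by [].
  rewrite /= diracE mem_set ?expr0//. by move=> [].

pose prod : {measure set (measurableTypeR R * E n)%type -> \bar R} :=
  (@lebesgue_measure R \x mu)%E.
pose pf : set (E n.+1) -> \bar R := pushforward prod (@tcons n).
pose pm : {measure set (E n.+1) -> \bar R} :=
  measure_function_pushforward__canonical__measure_function_Measure prod
    (@measurable_tcons n).
have pfbox c d : 0 < d -> pm (box c d) = ((d *+ 2) ^+ n.+1)%:E.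
  move=> d0; rewrite /pm/= /pushforward box_tcons /prod product_measure1E//=.
    rewrite lebesgue_measure_itv /= lte_fin ltrD2l gtrN// mubox// -EFinB -EFinM.
    by rewrite exprS; congr (_ * _)%:E; rewrite mulr2n; ring.
  exact: measurable_box.
have sf : sigma_finite setT pf.
  exists (fun k => box [tuple 0 | i < n.+1] k.+1%:R).
    apply/seteqP; split=> [t _|t _]; last by []; have [k kt] : exists k : nat, forall i, `|tnth t i| < k%:R.
      exists (\max_i Num.bound `|tnth t i|) => i.
      apply: (@lt_le_trans _ _ (Num.bound `|tnth t i|)%:R).
        by exact: archi_boundP.
      by rewrite ler_nat; exact: leq_bigmax.
    exists k => // i; rewrite tnth_mktuple subr0 (lt_trans (kt i))// ltr_nat//.
  move=> k; split; first exact: measurable_box.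
  by rewrite [pf _]pfbox// ltry.
pose sfm : {sigma_finite_measure set (E n.+1) -> \bar R} :=
  HB.pack pf (Measure.on pm) (Measure_isSigmaFinite.Build _ _ _ pm sf).
exists sfm => //=; by rewrite IH.
Qed.


Let leb_sf n := s2val (lebesgue_rn_sigma_finite_measure n).
Let lebE n : @lebesgue_rn R n = leb_sf n.
Proof. exact: (s2valP (lebesgue_rn_sigma_finite_measure n)). Qed.

Let leb0 n : @lebesgue_rn R n set0 = 0%E.
Proof. by rewrite lebE measure0. Qed.
Let leb_ge0 n A : (0 <= @lebesgue_rn R n A)%E.
Proof. by rewrite lebE. Qed.
Let leb_sigma_additive n : semi_sigma_additive (@lebesgue_rn R n).
Proof. by rewrite lebE; exact: measure_semi_sigma_additive. Qed.

HB.instance Definition _ n := isMeasure.Build _ _ _ (@lebesgue_rn R n)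
  (@leb0 n) (@leb_ge0 n) (@leb_sigma_additive n).

Let leb_sigma_finite n : sigma_finite setT (@lebesgue_rn R n).
Proof. by rewrite lebE; exact: sigma_finiteT. Qed.

HB.instance Definition _ n := Measure_isSigmaFinite.Build _ _ _
  (@lebesgue_rn R n) (@leb_sigma_finite n).

Lemma lebesgue_rn_box n (c : E n) d : 0 < d ->
  lebesgue_rn (box c d) = ((d *+ 2) ^+ n)%:E.
Proof. by move=> d0; rewrite lebE; exact: (s2valP' (lebesgue_rn_sigma_finite_measure n)). Qed.

Section fubini.
Variable n : nat.
Local Notation leb := (@lebesgue_measure R).
Local Notation lebn := (@lebesgue_rn R n).
Variable f : E n.+1 -> \bar R.

Lemma ge0_integral_lebesgue_rnS : measurable_fun [set: E n.+1] f ->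
    (forall t, (0 <= f t)%E) ->
  (\int[@lebesgue_rn R n.+1]_t f t = \int[leb]_x \int[lebn]_t f (tcons (x, t)))%E.
Proof.
move=> mf f0; have mc := @measurable_tcons n.
rewrite (@ge0_integral_pushforward _ _ _ _ _ _ mc (leb \x lebn)%E)//.
rewrite preimage_setT fubini_tonelli1//; last by move=> z; exact: f0.
exact: measurableT_comp.
Qed.


Hypothesis intf : (@lebesgue_rn R n.+1).-integrable setT f.

Let mf : measurable_fun [set: E n.+1] f. Proof. exact: (measurable_int _ intf). Qed.

Let intfc : (leb \x lebn)%E.-integrable setT (f \o @tcons n).
Proof.
have mc := @measurable_tcons n.
apply/integrableP; split; first exact: measurableT_comp.
move/integrableP : intf => [_].
rewrite (@ge0_integral_pushforward _ _ _ _ _ _ mc (leb \x lebn)%E)//.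
exact: measurableT_comp.
Qed.

Let integral_tcons : (\int[@lebesgue_rn R n.+1]_t f t =
  \int[leb \x lebn]_z f (tcons z))%E.
Proof.
by rewrite (@integral_pushforward _ _ _ _ _ _ (@measurable_tcons n) (leb \x lebn)%E).
Qed.

Lemma integral_lebesgue_rnS1 :
  (\int[@lebesgue_rn R n.+1]_t f t = \int[leb]_x \int[lebn]_t f (tcons (x, t)))%E.
Proof. by rewrite integral_tcons -integral12_prod_meas1. Qed.

Lemma integral_lebesgue_rnS2 :
  (\int[@lebesgue_rn R n.+1]_t f t = \int[lebn]_t \int[leb]_x f (tcons (x, t)))%E.
Proof. by rewrite integral_tcons -integral21_prod_meas1. Qed.

End fubini.

End lebesgue_rn_measure.

(** * Euclidean norm and measurability *)

Section euclid.
Variables (R : realType) (n : nat).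
Implicit Types (x y : 'rV[R]_n) (f : 'rV[R]_n -> R).
Local Notation E := (n.-tuple (measurableTypeR R)).

(** An open set of row vectors is a countable union of open cubes with rational
    centres, so measurability of the coordinates is enough. *)
Lemma measurable_fun_rV d (T : measurableType d) (g : T -> 'rV[R]_n)
    (f : 'rV[R]_n -> R) : continuous f ->
  (forall i, measurable_fun setT (fun t => g t 0 i)) ->
  measurable_fun setT (f \o g).
Proof.
move=> cf mg.
pose cube (q : 'rV[rat]_n * nat) : set 'rV[R]_n :=
  [set x | forall i, `|x 0 i - ratr (q.1 0 i)| < q.2.+1%:R^-1].
have mball (q : 'rV[rat]_n * nat) : measurable (g @^-1` cube q).
  have -> : g @^-1` (cube q) =
     \bigcap_(i in [set: 'I_n]) ((fun t => g t 0 i) @^-1`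
        `]ratr (q.1 0 i) - q.2.+1%:R^-1, ratr (q.1 0 i) + q.2.+1%:R^-1[).
    apply/seteqP; split=> [t H i _|t H i] /=.
      by rewrite in_itv /= -ltr_distl; exact: H.
    by have := H i I; rewrite /= in_itv /= -ltr_distl.
  apply: fin_bigcap_measurable => // i _.
  by rewrite -[X in measurable X]setTI; exact: mg.
have mopen (O : set 'rV[R]_n) : open O -> measurable (g @^-1` O).
  move=> oO.
  pose F (q : 'rV[rat]_n * nat) : set T :=
    if asbool (cube q `<=` O)
    then g @^-1` cube q else set0.
  have -> : g @^-1` O = \bigcup_q F q.
    apply/seteqP; split=> [t /= Ot|t [q _]]; last first.
      by rewrite /F; case: asboolP => // H /H.
    have /nbhs_ballP[e /= e0 eO] := oO _ Ot.
    have [k ke] : exists k : nat, k.+1%:R^-1 *+ 2 < e.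
      have e2 : 0 < e / 2 by rewrite divr_gt0.
      have [k _ kP] := near_infty_natSinv_lt (PosNum e2).
      by exists k; have := kP k (leqnn k); rewrite /= ltr_pdivlMr// mulr_natr.
    have /choice[q qP] : forall i, exists q, `|g t 0 i - ratr q| < k.+1%:R^-1.
      move=> i; have [|q] := @rat_in_itvoo R (g t 0 i - k.+1%:R^-1) (g t 0 i + k.+1%:R^-1).
        by rewrite ltrD2l gtrN.
      move=> qP; exists q; rewrite distrC ltr_distl; by move: qP; rewrite in_itv.

    exists (\row_i q i, k) => //; rewrite /F; case: asboolP => /= [_ i|[]].
      by rewrite mxE.
    move=> x xq; apply: eO; split => // a b; rewrite (ord1 a) /ball /=.
    have := xq b; have := qP b; rewrite mxE => H1 H2.
    rewrite (le_lt_trans (ler_distD (ratr (q b)) _ _))// (lt_trans _ ke)// mulr2n.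
    by rewrite ltrD // distrC.
  apply: countable_bigcupT_measurable; first exact: countableP.
  move=> q.
  by rewrite /F; case: ifP => _ //.
move=> _; apply: (measurability _ (RGenOpens.measurableE R)) => //.
move=> _ [_ [a [b ->] <-]]; rewrite setTI.
have := mopen (f @^-1` `]a, b[%classic); apply; move/continuousP : cf; apply; exact: interval_open.
Qed.

Lemma enorm_ge0 x : 0 <= enorm x.
Proof. exact: sqrtr_ge0. Qed.

Lemma enorm_sqr x : enorm x ^+ 2 = \sum_(i < n) x 0 i ^+ 2.
Proof. by rewrite sqr_sqrtr// sumr_ge0// => i _; exact: sqr_ge0. Qed.

Lemma enormZ (c : R) x : enorm (c *: x) = `|c| * enorm x.
Proof.
rewrite /enorm -sqrtr_sqr -sqrtrM ?sqr_ge0// mulr_sumr.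
by congr Num.sqrt; apply: eq_bigr => i _; rewrite mxE exprMn.
Qed.

Lemma normr_coord_le_enorm x i : `|x 0 i| <= enorm x.
Proof.
rewrite -sqrtr_sqr /enorm ler_wsqrtr// (bigD1 i)//= lerDl.
by rewrite sumr_ge0// => j _; exact: sqr_ge0.
Qed.

Lemma enorm_eq0 x : enorm x = 0 -> x = 0.
Proof.
move=> x0; apply/rowP => i; rewrite mxE; apply/eqP; rewrite -normr_le0 -x0.
exact: normr_coord_le_enorm.
Qed.

Lemma continuous_enorm_sqr : continuous (fun x : 'rV[R]_n => enorm x ^+ 2).
Proof.
under eq_fun do rewrite enorm_sqr.
apply: continuous_big => [|i _]; first exact: (@add_continuous R^o).
move=> x; apply: (@continuous_comp _ _ _ (fun y : 'rV[R]_n => y 0 i) (fun z : R => z ^+ 2)).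
  exact: coord_continuous.
exact: exprn_continuous.
Qed.

Lemma continuous_enorm : continuous (@enorm R n).
Proof.
move=> x; rewrite (_ : @enorm R n = fun y => Num.sqrt (enorm y ^+ 2)); last first.
  by apply/funext => y; rewrite sqrtr_sqr ger0_norm// enorm_ge0.
apply: continuous_comp; [exact: continuous_enorm_sqr|exact: sqrt_continuous].
Qed.

Lemma enorm_le x (d : R) : 0 <= d -> (forall i, `|x 0 i| <= d) ->
  enorm x <= Num.sqrt n%:R * d.
Proof.
move=> d0 xd; rewrite -[d in _ * d]ger0_norm// -sqrtr_sqr -sqrtrM// ler_wsqrtr//.
rewrite -[n in n%:R]card_ord -sumr_const mulr_suml ler_sum// => i _.
by rewrite mul1r -real_normK ?num_real// lerXn2r// nnegrE.
Qed.

Lemma compact_ball (r : R) : compact [set x : 'rV[R]_n | enorm x <= r].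
Proof.
apply: bounded_closed_compact.
  exists r; split; first exact: num_real.
  move=> M rM x /= xr; rewrite /Num.norm/= mx_normrE.
  have M0 : 0 <= M by rewrite (le_trans _ (ltW rM))// (le_trans _ xr)// enorm_ge0.
  apply: bigmax_le => // -[i j] _ /=; rewrite (ord1 i).
  by rewrite (le_trans (normr_coord_le_enorm _ _))// (le_trans xr)// ltW.
apply: (@closed_comp _ _ (@enorm R n) [set y | y <= r]) => [x _|].
  exact: continuous_enorm.
exact: closed_le.
Qed.

Lemma compact_esphere (r : R) : compact (@esphere R n r).
Proof.
apply: (@subclosed_compact _ _ [set x | enorm x <= r]).
- apply: (@closed_comp _ _ (@enorm R n) [set y | y = r]) => [x _|].
    exact: continuous_enorm.
  exact: closed_eq.
- exact: compact_ball.
- by move=> x /= ->.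
Qed.

Local Notation vec := (@vec_of_tuple R n).

Lemma measurable_vec_coord i : measurable_fun setT (fun t : E => vec t 0 i).
Proof.
under eq_fun do rewrite mxE.
exact: (@measurable_tnth _ (measurableTypeR R) n i).
Qed.

Lemma measurable_continuous_vec f : continuous f -> measurable_fun setT (f \o vec).
Proof. by move=> cf; apply: measurable_fun_rV => // i; exact: measurable_vec_coord. Qed.

Definition tball (r : R) : set E := [set t | enorm (vec t) <= r].

Lemma measurable_tball r : measurable (tball r).
Proof.
rewrite (_ : tball r = (@enorm R n \o vec) @^-1` `]-oo, r]%classic).
  rewrite -[X in measurable X]setTI.
  exact: (measurable_continuous_vec continuous_enorm).
by apply/seteqP; split=> t /=; rewrite in_itv.
Qed.

(** The point where the ray through [y] meets the sphere of radius [r]; the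
    value at the origin is the origin itself. *)
Definition radial (r : R) y : 'rV[R]_n := (r / enorm y) *: y.

Lemma enorm_radial r y : 0 <= r -> y != 0 -> enorm (radial r y) = r.
Proof.
move=> r0 y0; have ny : enorm y != 0 by apply: contra_neq y0 => /enorm_eq0.
by rewrite enormZ ger0_norm ?divr_ge0 ?enorm_ge0// divfK.
Qed.

Lemma radialZ r c y : 0 < c -> radial r (c *: y) = radial r y.
Proof.
move=> c0; rewrite /radial enormZ gtr0_norm// scalerA; congr (_ *: _).
have [->|ny] := eqVneq (enorm y) 0; first by rewrite mulr0 invr0 !mulr0 mul0r.
by field; rewrite ny gt_eqF.
Qed.

Lemma measurable_radial f r : continuous f ->
  measurable_fun setT (fun t : E => f (radial r (vec t))).
Proof.
move=> cf; apply: (@measurable_fun_rV _ _ (fun t => radial r (vec t)) f cf) => i.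
under eq_fun do rewrite mxE.
apply: measurable_funM; last exact: measurable_vec_coord.
apply: measurable_funM => //.
(* real powers are measurable functions, and [x^-1] is one of them *)
under eq_fun do rewrite -(powR_inv1 (enorm_ge0 _)).
apply: (measurableT_comp (measurable_powR (-1))).
exact: (measurable_continuous_vec continuous_enorm).
Qed.

End euclid.

(** * Dilations *)

Section scaling.
Variable R : realType.
Local Notation E n := (n.-tuple (measurableTypeR R)).
Local Notation leb := (@lebesgue_measure R).


Let dil (r : R) : measurableTypeR R -> measurableTypeR R := fun x => r * x.

Let measurable_dil r : measurable_fun setT (dil r).
Proof. exact: mulrl_measurable. Qed.

Lemma ge0_integral_lebesgue_scale (r : R) (f : R -> \bar R) : 0 < r ->
  measurable_fun [set: R] f -> (forall x, (0 <= f x)%E) ->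
  (\int[leb]_x f x = r%:E * \int[leb]_x f (r * x)%R)%E.
Proof.
move=> r0 mf f0; pose rn := NngNum (ltW r0).
pose mu : {measure set (measurableTypeR R) -> \bar R} := mscale rn
  (measure_function_pushforward__canonical__measure_function_Measure leb
     (measurable_dil r)).
have muE A : measurable A -> leb A = mu A.
  apply: lebesgue_measure_unique => //= _ [[a b]] _ <-.
  rewrite /mscale/= /pushforward.
  have -> : dil r @^-1` `]a, b] = `]a / r, b / r]%classic.
    by apply/seteqP; split=> x /=; rewrite !in_itv /= ltr_pdivrMr// ler_pdivlMr//
      /dil mulrC.
  rewrite !lebesgue_measure_itv/= !lte_fin ltr_pM2r ?invr_gt0//.
  case: ifPn => _; last by rewrite mule0.
  by rewrite -!EFinB -EFinM; congr EFin; field; rewrite gt_eqF.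
rewrite (eq_measure_integral mu); last by move=> A mA _; exact: muE.
rewrite ge0_integral_mscale//= (ge0_integral_pushforward (measurable_dil r))//.
Qed.

Definition tscale n (r : R) (t : E n) : E n := [tuple r * tnth t i | i < n].

Lemma measurable_tscale n r : measurable_fun [set: E n] (@tscale n r).
Proof.
apply/measurable_fun_tnthP => i.
rewrite (_ : _ \o _ = fun t => r * tnth t i); last first.
  by apply/funext => t /=; rewrite tnth_mktuple.
apply: (@measurable_funM _ _ _ _ (fun=> r) (fun t : E n => tnth t i)) => //.
exact: (@measurable_tnth _ (measurableTypeR R) n i).
Qed.

Lemma tscale_tcons n r (z : measurableTypeR R * E n) :
  tscale r (tcons z) = tcons (r * z.1, tscale r z.2).
Proof.
apply: eq_from_tnth => i; rewrite tnth_mktuple /tcons.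
case: (unliftP ord0 i) => [j ->|->]; last by rewrite !tnth0.
by rewrite !tnthS tnth_mktuple.
Qed.

(** The change of variables is one-dimensional, one coordinate at a time. *)
Lemma ge0_integral_lebesgue_rn_scale n (r : R) (f : E n -> \bar R) : 0 < r ->
  measurable_fun [set: E n] f -> (forall t, (0 <= f t)%E) ->
  (\int[@lebesgue_rn R n]_t f t =
   (r ^+ n)%:E * \int[@lebesgue_rn R n]_t f (tscale r t))%E.
Proof.
move=> r0; elim: n f => [|n IH] f mf f0.
  rewrite expr0 mul1e; apply: eq_integral => t _; congr f.
  by apply: eq_from_tnth => -[].
rewrite ge0_integral_lebesgue_rnS// ge0_integral_lebesgue_rnS//; last first.
  by apply: measurableT_comp => //; exact: measurable_tscale.
have mfc : measurable_fun [set: measurableTypeR R * E n] (f \o @tcons R n).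
  by apply: measurableT_comp => //; exact: measurable_tcons.
have mfx x : measurable_fun [set: E n] (fun t => f (tcons (x, t))).
  exact: (measurableT_comp mfc).
transitivity (\int[leb]_x ((r ^+ n)%:E * \int[@lebesgue_rn R n]_t
   f (tcons (x, tscale r t))))%E.
  by apply: eq_integral => x _; rewrite (IH (fun t => f (tcons (x, t)))).
have mfs : measurable_fun [set: measurableTypeR R * E n] (fun z => f (tcons (z.1, tscale r z.2))).
  apply: (measurableT_comp mfc); apply/measurable_fun_pairP; split.
    exact: measurable_fst.
  exact: (measurableT_comp (@measurable_tscale n r) (@measurable_snd _ _ (measurableTypeR R) (E n))).
have mi := measurable_fun_fubini_tonelli_F (m2 := @lebesgue_rn R n) _ mfs (fun z => f0 _).
rewrite ge0_integralZl//; last 2 first.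
- by move=> x _; apply: integral_ge0.
- by rewrite lee_fin exprn_ge0// ltW.
rewrite (ge0_integral_lebesgue_scale (f := fun x => \int[@lebesgue_rn R n]_t
   f (tcons (x, tscale r t)))%E r0); last 2 first.
- exact: mi.
- by move=> x; apply: integral_ge0.
rewrite muleA -EFinM -exprSr; congr (_ * _)%E.
apply: eq_integral => x _; apply: eq_integral => t _.
by rewrite tscale_tcons.
Qed.

Lemma vec_of_tscale n r (t : E n) : vec_of_tuple (tscale r t) = r *: vec_of_tuple t.
Proof. by apply/rowP => i; rewrite !mxE tnth_mktuple. Qed.

End scaling.

(** * Integrals over balls and spheres *)

Section means.
Variables (R : realType) (n : nat).
Implicit Types (x y : 'rV[R]_n) (f g : 'rV[R]_n -> R).
Local Notation E := (n.-tuple (measurableTypeR R)).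
Local Notation vec := (@vec_of_tuple R n).
Local Notation leb := (@lebesgue_rn R n).
Local Notation tball := (@tball R n).

Definition ball_int f (r : R) : R := (\int[leb]_(t in tball r) f (vec t))%R.

(** Up to the factor [n r^(n-1)], the surface integral of [f] over the sphere of
    radius [r]; dividing by [ball_vol] gives the mean of [f] over that sphere. *)
Definition sphere_int f (r : R) : R :=
  (\int[leb]_(t in tball 1) f (radial r (vec t)))%R.

Definition ball_vol : R := fine (leb (tball 1)).

Lemma lebesgue_rn_ball_lty r : (leb (tball r) < +oo)%E.
Proof.
pose d := `|r| + 1.
have d0 : 0 < d by rewrite ltr_wpDl.
apply: (@le_lt_trans _ _ (leb (box [tuple 0 | i < n] d))); last first.
  by rewrite lebesgue_rn_box// ltry.
apply: le_measure; rewrite ?inE.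
- exact: measurable_tball.
- exact: measurable_box.
move=> t tr i; rewrite tnth_mktuple subr0.
have := normr_coord_le_enorm (vec t) i; rewrite mxE => /le_lt_trans; apply.
by rewrite (le_lt_trans tr)// /d (le_lt_trans (ler_norm r))// ltrDl.
Qed.

Lemma ball_volE : leb (tball 1) = ball_vol%:E.
Proof. by rewrite fineK// ge0_fin_numE// lebesgue_rn_ball_lty. Qed.

Lemma box_sub_ball (c : E) d : 0 <= d ->
  exists r, 0 < r /\ box c d `<=` tball r.
Proof.
move=> d0; pose M := \sum_(i < n) `|tnth c i| + d.
have M0 : 0 <= M by rewrite addr_ge0// sumr_ge0.
exists (Num.sqrt n%:R * M + 1); split.
  by rewrite ltr_wpDl// mulr_ge0// sqrtr_ge0.
move=> t td; rewrite /tball/=; apply: (@le_trans _ _ (Num.sqrt n%:R * M)).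
  apply: enorm_le => // i; rewrite mxE.
  have -> : tnth t i = tnth c i + (tnth t i - tnth c i) by rewrite addrC subrK.
  rewrite (le_trans (ler_normD _ _))// lerD//; last exact: ltW.
  by rewrite (bigD1 i)//= lerDl sumr_ge0.
by rewrite lerDl.
Qed.

Lemma ball_vol_gt0 : 0 < ball_vol.
Proof.
pose d : R := (Num.sqrt n%:R + 1)^-1.
have s0 : 0 <= Num.sqrt n%:R :> R by exact: sqrtr_ge0.
have d0 : 0 < d by rewrite invr_gt0 ltr_wpDl.
rewrite -lte_fin -ball_volE.
apply: (@lt_le_trans _ _ (leb (box [tuple 0 | i < n] d))).
  by rewrite lebesgue_rn_box// lte_fin exprn_gt0// pmulrn_lgt0.
apply: le_measure; rewrite ?inE.
- exact: measurable_box.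
- exact: measurable_tball.
move=> t td; rewrite /tball/= (@le_trans _ _ (Num.sqrt n%:R * d))//.
  apply: enorm_le; first exact: ltW.
  by move=> i; rewrite mxE; have := td i; rewrite tnth_mktuple subr0 => /ltW.
by rewrite /d ler_pdivrMr ?ltr_wpDl// mul1r lerDl.
Qed.

Lemma continuous_bounded_ball f r : continuous f ->
  exists2 M, 0 <= M & forall x, enorm x <= r -> `|f x| <= M.
Proof.
move=> cf.
have /compact_bounded[M [_ Mf]] := continuous_compact (continuous_subspaceT cf) (@compact_ball R n r).
exists (`|M| + 1); first by rewrite addr_ge0.
move=> x xr; apply: Mf; last by exists x.
by rewrite (le_lt_trans (ler_norm M))// ltrDl.
Qed.

Lemma enorm_radial_le r y : 0 <= r -> enorm (radial r y) <= r.
Proof.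
move=> r0; have [->|y0] := eqVneq y 0; last by rewrite enorm_radial.
by rewrite /radial scaler0 -(scale0r (0 : 'rV[R]_n)) enormZ normr0 mul0r.
Qed.

Lemma integrable_ball f r : continuous f -> leb.-integrable (tball r) (EFin \o (f \o vec)).
Proof.
move=> cf; have [M M0 Mf] := continuous_bounded_ball r cf.
apply: measurable_bounded_integrable.
- exact: measurable_tball.
- exact: lebesgue_rn_ball_lty.
- apply: measurable_funTS; exact: measurable_continuous_vec.
- exists M; split; first exact: num_real.
  by move=> N MN t /= tr; rewrite (le_trans (Mf _ _))// ltW.
Qed.

Lemma integrable_radial f r s : continuous f -> 0 <= r ->
  leb.-integrable (tball s) (EFin \o (fun t => f (radial r (vec t)))).
Proof.
move=> cf r0; have [M M0 Mf] := continuous_bounded_ball r cf.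
apply: measurable_bounded_integrable.
- exact: measurable_tball.
- exact: lebesgue_rn_ball_lty.
- apply: measurable_funTS; exact: measurable_radial.
- exists M; split; first exact: num_real.
  by move=> N MN t /= tr; rewrite (le_trans (Mf _ _))// ?enorm_radial_le// ltW.
Qed.

Lemma ge0_integral_ball_scale (F : 'rV[R]_n -> \bar R) r : 0 < r ->
  measurable_fun [set: E] (F \o vec) -> (forall x, (0 <= F x)%E) ->
  (\int[leb]_(t in tball r) F (vec t) =
   (r ^+ n)%:E * \int[leb]_(t in tball 1) F (r *: vec t))%E.
Proof.
move=> r0 mF F0.
rewrite integral_mkcond (ge0_integral_lebesgue_rn_scale r0).
- rewrite [in RHS]integral_mkcond; congr (_ * _)%E; apply: eq_integral => t _.
  rewrite /patch vec_of_tscale; congr (if _ then _ else _).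
  apply/idP/idP; rewrite !inE /tball/= vec_of_tscale enormZ gtr0_norm//;
    by rewrite -{2}[r]mulr1 ler_pM2l.
- apply/(measurable_restrictT _ _).1; first exact: measurable_tball.
  exact: measurable_funTS.
- by move=> t; apply: erestrict_ge0.
Qed.

(** Polar coordinates for a function that is constant along rays: the dilation
    [y |-> s y] leaves the integrand unchanged. *)
Lemma ball_int_radial f r s : 0 < s -> 0 <= r -> continuous f -> (forall x, 0 <= f x) ->
  (\int[leb]_(t in tball s) f (radial r (vec t)))%R = s ^+ n * sphere_int f r.
Proof.
move=> s0 r0 cf f0; rewrite /sphere_int /Rintegral.
rewrite (ge0_integral_ball_scale (F := fun x => (f (radial r x))%:E) s0); last 2 first.
- apply/measurable_EFinP; exact: measurable_radial.
- by move=> x; rewrite lee_fin.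
rewrite fineM//.
  by congr (_ * fine _); apply: eq_integral => t _; rewrite radialZ.
under eq_integral do rewrite radialZ//.
apply: integrable_fin_num; first exact: measurable_tball.
exact: integrable_radial.
Qed.


Lemma sphere_int_cst c r : sphere_int (fun=> c) r = c * ball_vol.
Proof. by rewrite /sphere_int Rintegral_cst//; exact: measurable_tball. Qed.

Lemma le_ball_int f g r : continuous f -> continuous g ->
  (forall x, enorm x <= r -> f x <= g x) -> ball_int f r <= ball_int g r.
Proof.
move=> cf cg fg; apply: le_Rintegral.
- exact: measurable_tball.
- exact: integrable_ball.
- exact: integrable_ball.
- by move=> t tr; exact: fg.
Qed.

Lemma ball_int_ge0 f r : (forall x, 0 <= f x) -> 0 <= ball_int f r.
Proof. by move=> f0; apply: Rintegral_ge0. Qed.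

Lemma sphere_int_ge0 f r : (forall x, 0 <= f x) -> 0 <= sphere_int f r.
Proof. by move=> f0; apply: Rintegral_ge0. Qed.

Lemma ball_intD f g r : continuous f -> continuous g ->
  ball_int (fun x => f x + g x) r = ball_int f r + ball_int g r.
Proof.
move=> cf cg; apply: RintegralD.
- exact: measurable_tball.
- exact: integrable_ball.
- exact: integrable_ball.
Qed.

Lemma ball_intZ c f r : continuous f ->
  ball_int (fun x => c * f x) r = c * ball_int f r.
Proof.
move=> cf; apply: RintegralZl.
- exact: measurable_tball.
- exact: integrable_ball.
Qed.

Let measurable_origin : measurable [set t | vec t = 0].
Proof.
rewrite (_ : [set t | _] = tball 0); first exact: measurable_tball.
apply/seteqP; split=> t; rewrite /tball/=.
  by move=> ->; rewrite -(scale0r (0 : 'rV[R]_n)) enormZ normr0 mul0r.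
by move=> t0; apply: enorm_eq0; apply/eqP; rewrite eq_le t0 enorm_ge0.
Qed.

(** The origin, where the radial projection degenerates, is a null set. *)
Lemma lebesgue_rn_origin : (0 < n)%N -> leb [set t | vec t = 0] = 0%E.
Proof.
move=> n0; apply/eqP; rewrite eq_le measure_ge0 andbT.
apply/lee_addgt0Pr => e e0; rewrite add0e.
pose d := Num.min (e / 2) (1 / 2).
have d0 : 0 < d by rewrite lt_min !divr_gt0.
apply: (@le_trans _ _ (leb (box [tuple 0 | i < n] d))).
  apply: le_measure; rewrite ?inE.
  - exact: measurable_origin.
  - exact: measurable_box.
  - move=> t /= /rowP t0 i; rewrite tnth_mktuple subr0.
    by have := t0 i; rewrite !mxE => ->; rewrite normr0.
rewrite lebesgue_rn_box// lee_fin -(prednK n0) exprS.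
have d1 : d *+ 2 <= 1.
  by rewrite -mulr_natr -ler_pdivlMr// ge_min lexx orbT.
have d2 : d *+ 2 <= e.
  by rewrite -mulr_natr -ler_pdivlMr// ge_min lexx.
rewrite (le_trans _ d2)// ler_piMr ?mulrn_wge0 ?(ltW d0)//.
by rewrite exprn_ile1// mulrn_wge0// ltW.
Qed.

Lemma le_sphere_int f g r : (0 < n)%N -> 0 <= r -> continuous f -> continuous g ->
  (forall x, enorm x = r -> f x <= g x) -> sphere_int f r <= sphere_int g r.
Proof.
move=> n0 r0 cf cg fg; rewrite /sphere_int.
have mN := measurable_origin.
have me := @measurable_tball R n 1.
have i1 := integrable_radial 1 cf r0.
have i2 := integrable_radial 1 cg r0.
rewrite /Rintegral (negligible_integral _ _ i1 (lebesgue_rn_origin n0))//.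
rewrite (negligible_integral _ _ i2 (lebesgue_rn_origin n0))//.
apply: le_Rintegral.
- exact: measurableD.
- by apply: integrableS i1 => //; exact: measurableD.
- by apply: integrableS i2 => //; exact: measurableD.
- by move=> t [_ /= /eqP t0]; apply: fg; rewrite enorm_radial.
Qed.

Lemma eq_sphere_int f g r : (0 < n)%N -> 0 <= r -> continuous f -> continuous g ->
  (forall x, enorm x = r -> f x = g x) -> sphere_int f r = sphere_int g r.
Proof.
move=> n0 r0 cf cg fg; apply/eqP; rewrite eq_le !le_sphere_int// => x xr;
  by rewrite fg.
Qed.

End means.

(** * The radial derivative of a ball integral *)

Section radial_derivative.
Variables (R : realType) (n : nat).
Implicit Types (x y : 'rV[R]_n) (f g : 'rV[R]_n -> R).
Local Notation E := (n.-tuple (measurableTypeR R)).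
Local Notation vec := (@vec_of_tuple R n).
Local Notation leb := (@lebesgue_rn R n).
Local Notation tball := (@tball R n).

(** Uniform continuity across the sphere, by compactness: writing
    [x = (s / r) y] with [y] on the sphere of radius [r], the claim holds for
    [s] near [r] locally uniformly in [y]. *)
Lemma near_radial f (r e : R) : continuous f -> 0 < r -> 0 < e ->
  \forall s \near r, forall x, enorm x = s -> `|f x - f (radial r x)| < e.
Proof.
move=> cf r0 e0.
have rn : r != 0 by rewrite gt_eqF.
have /compact_near_coveringP cov := @compact_esphere R n r.
have H : \forall s \near r, @esphere R n r `<=`
    (fun y => `|f ((s / r) *: y) - f y| < e).
  apply: (cov R (nbhs r) (fun s y => `|f ((s / r) *: y) - f y| < e) _) => y yr.
  have c1 : (fun z : 'rV[R]_n * R => f ((z.2 / r) *: z.1) - f z.1) z @[z --> (y, r)]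
      --> f ((r / r) *: y) - f y.
    apply: cvgB; last by apply: (@cvg_comp _ _ _ fst f _ (nbhs y)); [exact: cvg_fst|exact: cf].
    apply: (@cvg_comp _ _ _ (fun z : 'rV[R]_n * R => (z.2 / r) *: z.1) f _
      (nbhs ((r / r) *: y))); last exact: cf.
    by apply: cvgZ; [apply: cvgMl; exact: cvg_snd|exact: cvg_fst].
  rewrite divff// scale1r subrr in c1.
  have /= := cvgr_norm_lt _ c1.
  rewrite normr0 => /(_ _ e e0); exact.
near=> s => x xs.
have s0 : 0 < s by near: s; exact: lt_nbhsr.
have x0 : x != 0.
  apply: contraTneq s0 => x0; rewrite -xs x0 -(scale0r (0 : 'rV[R]_n)) enormZ.
  by rewrite normr0 mul0r ltxx.
have Hs : esphere r `<=` (fun y => `|f ((s / r) *: y) - f y| < e) by near: s.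
have := Hs (radial r x).
rewrite /esphere/= enorm_radial ?ltW// => /(_ erefl).
rewrite {1}/radial scalerA xs (_ : s / r * (r / s) = 1) ?scale1r//.
by field; rewrite rn gt_eqF.
Unshelve. all: by end_near. Qed.

(** In a thin shell [f] is nearly constant along rays, so that its integral is
    nearly the one given by [ball_int_radial]. *)
Lemma ball_int_shell f (r a b e : R) : continuous f -> (forall x, 0 <= f x) ->
  0 <= r -> 0 < a -> a <= b -> 0 <= e ->
  (forall x, a < enorm x <= b -> `|f x - f (radial r x)| <= e) ->
  `|(ball_int f b - ball_int f a) - (b ^+ n - a ^+ n) * sphere_int f r|
    <= e * ((b ^+ n - a ^+ n) * ball_vol R n).
Proof.
move=> cf f0 r0 a0 ab e0 fe; have b0 := lt_le_trans a0 ab.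
have [ma mb] := (@measurable_tball R n a, @measurable_tball R n b).
have eab : tball a `<=` tball b by move=> t ta; rewrite /tball/= (le_trans ta).
pose S := tball b `\` tball a.
have mS : measurable S by exact: measurableD.
have split_int (h : E -> R) : leb.-integrable (tball b) (EFin \o h) ->
    (\int[leb]_(t in tball b) h t - \int[leb]_(t in tball a) h t =
     \int[leb]_(t in S) h t)%R.
  move=> ih; have UE : tball a `|` S = tball b by rewrite setDUK.
  rewrite -UE Rintegral_setU//; [by rewrite addrC addKr|by rewrite UE|].
  by apply/disj_setPS; rewrite /S setDE setICA setICr setI0.
have SB : S `<=` tball b by move=> t [].
have if_ := integrable_ball b cf.
have ir := integrable_radial b cf r0.
have ic c : leb.-integrable (tball b) (EFin \o (fun t => c : R)).
  have := integrable_ball b (@cst_continuous 'rV[R]_n R c).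
  exact.
rewrite [X in `|X - _|](split_int (f \o vec))//.
have -> : (b ^+ n - a ^+ n) * sphere_int f r =
    (\int[leb]_(t in S) f (radial r (vec t)))%R.
  by rewrite mulrBl -!ball_int_radial// split_int.
have -> : e * ((b ^+ n - a ^+ n) * ball_vol R n) = (\int[leb]_(t in S) e)%R.
  rewrite -split_int// mulrCA -(@sphere_int_cst _ n e r) mulrBl.
  by rewrite -!ball_int_radial//; exact: cst_continuous.
have i1 := integrableS mb mS SB if_.
have i2 := integrableS mb mS SB ir.
rewrite -RintegralB//.
have id : leb.-integrable S (EFin \o (fun t => f (vec t) - f (radial r (vec t)))).
  exact: (integrableB mS i1 i2).
apply: (le_trans (le_normr_Rintegral mS id)).
apply: le_Rintegral => //.
- exact: (integrable_norm id).
- exact: (integrableS mb mS SB (ic e)).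
- by move=> t [tb /= /negP ta]; apply: fe; rewrite ltNge ta; exact: tb.
Qed.

(** An increment that is small compared with the increment of a differentiable
    function has derivative zero. *)
Lemma is_derive_dominated (F H : R -> R) (r dH : R) : is_derive r 1 H dH ->
  (forall e, 0 < e -> \forall s \near r, `|F s - F r| <= e * `|H s - H r|) ->
  is_derive r 1 F 0.
Proof.
move=> [dvH HE] FH.
have dH0 : 0 < `|dH| + 1 by rewrite ltr_wpDl.
have cH : h^-1 *: (H (h *: 1 + r) - H r) @[h --> 0^'] --> dH.
  by rewrite -HE; exact: dvH.
have c0 : h^-1 *: (F (h *: 1 + r) - F r) @[h --> 0^'] --> (0 : R).
  apply/cvgr0Pnorm_le => e e0.
  have e10 : 0 < e / (`|dH| + 1) by rewrite divr_gt0.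
  have nr : \forall h \near 0^', `|F (h *: 1 + r) - F r| <=
      e / (`|dH| + 1) * `|H (h *: 1 + r) - H r|.
    have c : (h : R) *: (1 : R) + r @[h --> 0^'] --> r.
      rewrite (_ : (fun h : R => _) = (fun h => h + r)); last first.
        by apply/funext => h; rewrite /GRing.scale/= mulr1.
      rewrite -[X in _ --> X]add0r; apply: cvgD; last exact: cvg_cst.
      exact: (@nbhs_dnbhs R^o 0).
    exact: c (FH _ e10).
  have bH : \forall h \near 0^', `|h^-1 *: (H (h *: 1 + r) - H r)| <= `|dH| + 1.
    by apply: (cvgr_norm_le _ cH); rewrite ltrDl.
  near=> h.
  have F1 : `|F (h *: 1 + r) - F r| <= e / (`|dH| + 1) * `|H (h *: 1 + r) - H r|.
    by near: h.
  have H1 : `|h^-1 *: (H (h *: 1 + r) - H r)| <= `|dH| + 1 by near: h.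
  rewrite normrZ (le_trans (ler_wpM2l (normr_ge0 _) F1))//.
  rewrite mulrCA -normrZ (le_trans (ler_wpM2l (ltW e10) H1))//.
  by rewrite divfK// gt_eqF.
by split; [apply/cvg_ex; exists 0|apply: cvg_lim].
Unshelve. all: by end_near. Qed.

Lemma is_derive_pow k (r : R) :
  is_derive r (1 : R) (fun s : R => s ^+ k) (k%:R * r ^+ k.-1).
Proof.
have := @is_deriveX _ _ (id : R -> R) k r 1 1 (is_derive_id _ _).
by rewrite /GRing.scale/= mulr1 (_ : _ ^+ k = fun s : R => s ^+ k)// fctE.
Qed.

(** By [ball_int_shell], [ball_int f] has the same first-order behaviour at [r]
    as [s |-> s^n * sphere_int f r]. *)
Lemma is_derive_ball_int f (r : R) : continuous f -> (forall x, 0 <= f x) -> 0 < r ->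
  is_derive r 1 (ball_int f) (n%:R * r ^+ n.-1 * sphere_int f r).
Proof.
move=> cf f0 r0; pose H (s : R) := s ^+ n.
have dH : is_derive r 1 H (n%:R * r ^+ n.-1).
  exact: is_derive_pow.
pose F (s : R) := ball_int f s - H s * sphere_int f r.
have dF : is_derive r 1 F 0.
  apply: (is_derive_dominated dH) => e e0.
  have k0 := ball_vol_gt0 R n.
  have e10 : 0 < e / ball_vol R n by rewrite divr_gt0.
  have [d /= d0 dP] := near_radial cf r0 e10.
  have FE a b : 0 < a -> a <= b -> `|a - r| < d -> `|b - r| < d ->
      `|F b - F a| <= e * `|H b - H a|.
    move=> a0 ab ad bd.
    have H0 : 0 <= H b - H a.
      by rewrite subr_ge0 /H lerXn2r// nnegrE ltW// (lt_le_trans a0).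
    have -> : F b - F a =
        (ball_int f b - ball_int f a) - (b ^+ n - a ^+ n) * sphere_int f r.
      by rewrite /F /H; ring.
    apply: (le_trans (ball_int_shell cf f0 (ltW r0) a0 ab (ltW e10) _)).
      move=> x /andP[ax xb]; apply/ltW; apply: dP (erefl (enorm x)) => //=.
      rewrite distrC ltr_distl; move: ad bd; rewrite !ltr_distl.
      move=> /andP[? ?] /andP[? ?].
      by apply/andP; split; lra.
    by rewrite (ger0_norm H0) mulrCA divfK ?gt_eqF// mulrC.
  near=> s.
  have s0 : 0 < s by near: s; exact: lt_nbhsr.
  have sd : `|s - r| < d.
    by near: s; apply/nbhs_ballP; exists d => //= s; rewrite /ball/= distrC.
  have rd : `|r - r| < d by rewrite subrr normr0.
  have [rs|sr] := leP r s; first exact: FE.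
  by rewrite distrC [in leRHS]distrC; apply: FE => //; exact: ltW.
have -> : ball_int f = F \+ (fun s => sphere_int f r *: H s).
  by apply/funext => s; rewrite /F/= /GRing.scale/= [_ * H s]mulrC subrK.
apply: is_derive_eq.
by rewrite add0r /GRing.scale/= mulrC.
Unshelve. all: by end_near. Qed.

End radial_derivative.

(** * Integration by parts along chords *)

Section lines.
Variable R : realType.
Local Notation E n := (n.-tuple (measurableTypeR R)).
Local Notation leb := (@lebesgue_measure R).

Definition set_coord n (t : E n) (i : 'I_n) (s : R) : E n :=
  [tuple if j == i then s else tnth t j | j < n].

Lemma set_coord_head n (t : E n) (x s : R) : set_coord (tcons (x, t)) ord0 s = tcons (s, t).
Proof.
apply: eq_from_tnth => j; rewrite tnth_mktuple.
by case: (unliftP ord0 j) => [k ->|->]; rewrite /tcons ?tnthS ?tnth0 //= tnthS.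
Qed.

Lemma set_coord_tail n (t : E n) (i : 'I_n) (x s : R) :
  set_coord (tcons (x, t)) (lift ord0 i) s = tcons (x, set_coord t i s).
Proof.
apply: eq_from_tnth => j; rewrite tnth_mktuple.
case: (unliftP ord0 j) => [k ->|->]; last by rewrite /tcons !tnth0.
by rewrite (inj_eq lift_inj) /tcons !tnthS tnth_mktuple.
Qed.

Lemma integrable_bounded_box n (H : E n -> R) (M K : R) : 0 < K ->
  measurable_fun setT H -> (forall t, `|H t| <= M) ->
  (forall t, ~ box [tuple 0 | i < n] K t -> H t = 0) ->
  (@lebesgue_rn R n).-integrable setT (EFin \o H).
Proof.
move=> K0 mH HM H0; have mb := @measurable_box R n [tuple 0 | i < n] K.
have -> : EFin \o H = (EFin \o H) \_ (box [tuple 0 | i < n] K).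
  apply/funext => t; rewrite patchE; case: ifPn => // /negP; rewrite inE => tK.
  by rewrite /= H0.
apply/integrable_restrict => //; rewrite setTI.
have boo : (lebesgue_rn (box [tuple 0%R | i < n] K) < +oo)%E.
  by rewrite lebesgue_rn_box// ltry.
apply: measurable_bounded_integrable => //.
- exact: measurable_funTS.
- exists M; split; first exact: num_real.
  by move=> N MN t _; exact: (le_trans (HM t) (ltW MN)).
Qed.

(** If the integral over every line parallel to one coordinate axis vanishes,
    so does the whole integral: Fubini's theorem, peeling off the coordinates
    one at a time until the distinguished one is the outermost. *)
Lemma integral_lines_eq0 n (i : 'I_n) (H : E n -> R) (M K : R) : 0 < K ->
  measurable_fun setT H -> (forall t, `|H t| <= M) ->
  (forall t, ~ box [tuple 0 | i < n] K t -> H t = 0) ->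
  (forall t, (\int[leb]_s (H (set_coord t i s))%:E = 0)%E) ->
  (\int[@lebesgue_rn R n]_t (H t)%:E = 0)%E.
Proof.
move=> K0; elim: n i H => [[]//|n IH] i H mH HM H0 Hline.
have iH := integrable_bounded_box K0 mH HM H0.
case: (unliftP ord0 i) => [j ij|i0]; last first.
  rewrite (integral_lebesgue_rnS2 iH); apply: integral0_eq => t _.
  rewrite -[RHS](Hline (tcons (0, t))) i0.
  by apply: eq_integral => s _; rewrite set_coord_head.
rewrite (integral_lebesgue_rnS1 iH); apply: integral0_eq => x _.
apply: (IH j (fun t => H (tcons (x, t)))) => //.
- have mx : measurable_fun [set: E n] (fun t => tcons (x, t)).
    exact: (@measurable_cons _ _ (E n) (measurableTypeR R) (fun=> x) n id).
  exact: (measurableT_comp mH mx).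
- move=> t tK; apply: H0 => Hb; apply: tK => k.
  by have := Hb (lift ord0 k); rewrite /tcons !tnth_mktuple tnthS.
- move=> t; rewrite -[RHS](Hline (tcons (x, t))) ij.
  by apply: eq_integral => s _; rewrite set_coord_tail.
Qed.

End lines.

Lemma is_derive_congr (R : realType) (f g : R -> R) (s df dg : R) :
  is_derive s 1 f df -> f =1 g -> df = dg -> is_derive s 1 g dg.
Proof. by move=> dff /funext <- <-. Qed.

(** Green's second identity on a line, in the form [(a w - b w')' = a' w - b w'']
    with [b' = a] and [w = (C - s^2)^2]. *)
Lemma is_derive_green_1d (R : realType) (a b : R -> R) (a' C s : R) :
  is_derive s 1 a a' -> is_derive s 1 b (a s) ->
  is_derive s 1 (fun s => a s * (C - s ^+ 2) ^+ 2 - b s * (- 4 * s * (C - s ^+ 2)))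
    (a' * (C - s ^+ 2) ^+ 2 - b s * (8 * s ^+ 2 - 4 * (C - s ^+ 2))).
Proof.
move=> da db.
have dc : is_derive s (1 : R) (fun s : R => C - s ^+ 2) (- (2 * s)).
  have := is_deriveB (is_derive_cst C s 1) (is_derive_pow 2 s).
  by rewrite sub0r expr1.
have da2 := is_deriveM da (is_deriveM dc dc).
have db1 := is_deriveM db (is_deriveM dc (is_derive_id s (1 : R))).
apply: is_derive_congr (is_deriveB da2 (is_deriveZ (- 4) db1)) _ _.
  by move=> y; rewrite !fctE/= /GRing.scale/=; ring.
by rewrite !fctE/= /GRing.scale/=; ring.
Qed.

Section green.
Variables (R : realType) (n : nat).
Implicit Types (x y : 'rV[R]_n) (f g : 'rV[R]_n -> R) (i : 'I_n).
Local Notation E := (n.-tuple (measurableTypeR R)).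
Local Notation vec := (@vec_of_tuple R n).
Local Notation leb := (@lebesgue_rn R n).
Local Notation tball := (@tball R n).
Local Notation e_ i := (delta_mx 0 i : 'rV[R]_n).

(** A directional derivative along a basis vector is an ordinary derivative
    along the corresponding line. *)
Lemma is_derive_line f x i (s : R) :
  partially_derivable i f ->
  is_derive s 1 (fun s => f (x + s *: e_ i)) (partial i f (x + s *: e_ i)).
Proof.
move=> df; have := df (x + s *: e_ i).
rewrite /partial /derivable /derive => c.
have E1 : (fun h : R => h^-1 *: ((fun s => f (x + s *: e_ i)) (h *: 1 + s) - f (x + s *: e_ i))) =
  (fun h => h^-1 *: ((f : _ -> R^o) (h *: e_ i + (x + s *: e_ i)) - (f : _ -> R^o) (x + s *: e_ i))).
  apply/funext => h; congr (_ *: (f _ - _)).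
  have h1 : h *: (1 : R) = h by exact: mulr1.
  by rewrite h1 scalerDl addrCA.
split; first by rewrite /derivable E1.
by rewrite /derive E1.
Qed.

Lemma continuous_line x i : continuous (fun s : R => x + s *: e_ i).
Proof.
move=> s; apply: cvgD; first exact: cvg_cst.
by apply: cvgZ; [exact: cvg_id|exact: cvg_cst].
Qed.

Lemma coord_line x i j s : (x + s *: e_ i) 0 j = x 0 j + (j == i)%:R * s.
Proof. by rewrite !mxE eqxx/= mulrC. Qed.

Lemma enorm_sqr_line x i s : x 0 i = 0 ->
  enorm (x + s *: e_ i) ^+ 2 = s ^+ 2 + enorm x ^+ 2.
Proof.
move=> xi; rewrite !enorm_sqr (bigD1 i)//= [in RHS](bigD1 i)//=.
rewrite coord_line eqxx xi mul1r add0r expr0n/= add0r; congr (_ + _).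
by apply: eq_bigr => j /negPf ji; rewrite coord_line ji mul0r addr0.
Qed.

(** The weight [(r^2 - |x|^2)^2] and its first two derivatives in a coordinate
    direction; the weight vanishes to second order on the sphere of radius
    [r], so that integrating by parts twice leaves no boundary term. *)
Definition weight (r : R) x : R := (r ^+ 2 - enorm x ^+ 2) ^+ 2.
Definition weight1 (r : R) i x : R := - 4 * x 0 i * (r ^+ 2 - enorm x ^+ 2).
Definition weight2 (r : R) i x : R :=
  8 * x 0 i ^+ 2 - 4 * (r ^+ 2 - enorm x ^+ 2).

Definition green_integrand (r : R) i f x : R :=
  partial i (partial i f) x * weight r x - f x * weight2 r i x.

Definition green_primitive (r : R) i f x : R :=
  partial i f x * weight r x - f x * weight1 r i x.

Lemma is_derive_green_primitive (r : R) i f x (s : R) : C2 f -> x 0 i = 0 ->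
  is_derive s 1 (fun s => green_primitive r i f (x + s *: e_ i))
    (green_integrand r i f (x + s *: e_ i)).
Proof.
move=> [[_ /(_ i)[df _]] /(_ i)[_ /(_ i)[ddf _]]] xi.
have d1 := is_derive_line x s df.
have d2 := is_derive_line x s ddf.
pose C := r ^+ 2 - enorm x ^+ 2.
have WE z : r ^+ 2 - enorm (x + z *: e_ i) ^+ 2 = C - z ^+ 2.
  by rewrite enorm_sqr_line// /C; ring.
have cE z : (x + z *: e_ i) 0 i = z by rewrite coord_line eqxx mul1r xi add0r.
apply: is_derive_congr (is_derive_green_1d C d2 d1) _ _.
  by move=> z; rewrite /green_primitive /weight /weight1 WE cE.
by rewrite /green_integrand /weight /weight2 WE cE.
Qed.

End green.

(** * Green's identity on a ball *)

Section green_identity.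
Variables (R : realType) (n : nat).
Implicit Types (x y : 'rV[R]_n) (f g : 'rV[R]_n -> R) (i : 'I_n).
Local Notation E := (n.-tuple (measurableTypeR R)).
Local Notation vec := (@vec_of_tuple R n).
Local Notation leb := (@lebesgue_rn R n).
Local Notation tball := (@tball R n).
Local Notation e_ i := (delta_mx 0 i : 'rV[R]_n).

Lemma continuousMf f g : continuous f -> continuous g -> continuous (fun x => f x * g x).
Proof. by move=> cf cg x; apply: (@cvgM R _ (nbhs x) _ f g (f x) (g x)); [exact: cf|exact: cg]. Qed.

Lemma continuousDf f g : continuous f -> continuous g -> continuous (fun x => f x + g x).
Proof. by move=> cf cg x; apply: (@cvgD R R^o _ (nbhs x) _ f g (f x) (g x)); [exact: cf|exact: cg]. Qed.

Lemma continuousBf f g : continuous f -> continuous g -> continuous (fun x => f x - g x).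
Proof. by move=> cf cg x; apply: (@cvgB R R^o _ (nbhs x) _ f g (f x) (g x)); [exact: cf|exact: cg]. Qed.

Lemma continuous_coord i : continuous (fun x => x 0 i).
Proof. exact: coord_continuous. Qed.

Lemma continuous_cst (c : R) : continuous (fun _ : 'rV[R]_n => c).
Proof. exact: cst_continuous. Qed.

Lemma continuous_weight (r : R) : continuous (@weight R n r).
Proof.
have c : continuous (fun x => r ^+ 2 - enorm x ^+ 2).
  exact: (continuousBf (@continuous_cst _) (@continuous_enorm_sqr R n)).
exact: (continuousMf c c).
Qed.

Lemma continuous_weight2 (r : R) i : continuous (@weight2 R n r i).
Proof.
have ci := @continuous_coord i.
apply: continuousBf; apply: continuousMf; try exact: continuous_cst.
  exact: (continuousMf ci ci).
exact: (continuousBf (@continuous_cst _) (@continuous_enorm_sqr R n)).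
Qed.

Lemma continuous_green_integrand (r : R) i f : C2 f -> continuous (green_integrand r i f).
Proof.
move=> [[cf _] /(_ i)[_ /(_ i)[_ cd]]]; apply: continuousBf.
  by apply: continuousMf => //; exact: continuous_weight.
by apply: continuousMf => //; exact: continuous_weight2.
Qed.

Lemma vec_set_coord (t : E) i s :
  vec (set_coord t i s) = vec (set_coord t i 0) + s *: e_ i.
Proof.
apply/rowP => j; rewrite coord_line !mxE !tnth_mktuple.
by case: eqP => _; rewrite ?mul1r ?add0r ?mul0r ?addr0.
Qed.

(** On a chord of the ball parallel to a coordinate axis the integrand is the
    derivative of a function vanishing at both ends of the chord. *)
Lemma integral_green_chord (r : R) i f x : 0 < r -> C2 f -> x 0 i = 0 ->
  (\int[@lebesgue_measure R]_(s in [set s | enorm (x + s *: e_ i) <= r]%R)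
     (green_integrand r i f (x + s *: e_ i))%:E = 0)%E.
Proof.
move=> r0 C2f xi.
have eE s : (enorm (x + s *: e_ i) <= r) = (s ^+ 2 <= r ^+ 2 - enorm x ^+ 2).
  rewrite -(ler_pXn2r (ltn0Sn 1)) ?nnegrE ?enorm_ge0 ?(ltW r0)//.
  by rewrite enorm_sqr_line// lerBrDr.
have [neg|pos] := ltP (r ^+ 2 - enorm x ^+ 2) 0.
  rewrite (_ : [set s | _] = set0) ?integral_set0//; apply/seteqP; split=> // s /=.
  by rewrite eE leNgt (lt_le_trans neg)// sqr_ge0.
(* half the length of the chord *)
pose c := Num.sqrt (r ^+ 2 - enorm x ^+ 2).
have c2 : c ^+ 2 = r ^+ 2 - enorm x ^+ 2 by rewrite sqr_sqrtr.
have c0 : 0 <= c by exact: sqrtr_ge0.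
have -> : [set s | enorm (x + s *: e_ i) <= r] = `[- c, c]%classic.
  have sE s : (s ^+ 2 <= c ^+ 2) = (`|s| <= c).
    by rewrite -[in RHS](ler_pXn2r (ltn0Sn 1)) ?nnegrE// real_normK ?num_real.
  by apply/seteqP; split=> s /=; rewrite eE -c2 in_itv/= -ler_norml sE.
have [c00|cn0] := eqVneq c 0.
  by rewrite c00 oppr0 set_itv1 integral_set1.
have cgt : - c < c by rewrite gtrN// lt_neqAle eq_sym cn0.
pose F s := green_primitive r i f (x + s *: e_ i).
have dF (s : R) : is_derive s 1 F (green_integrand r i f (x + s *: e_ i)).
  exact: is_derive_green_primitive.
have cF : continuous F.
  by move=> s; apply: differentiable_continuous; apply/derivable1_diffP; have [] := dF s.
have Fend s : s ^+ 2 = c ^+ 2 -> F s = 0.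
  move=> sc; rewrite /F /green_primitive /weight /weight1 enorm_sqr_line// sc c2.
  by rewrite subrK subrr expr0n/= !mulr0 subrr.
rewrite (@continuous_FTC2 _ _ F)//.
- by rewrite !Fend ?sqrrN// subee.
- apply: continuous_subspaceT => s.
  apply: (@cvg_comp _ _ _ (fun s => x + s *: e_ i) (green_integrand r i f) _
    (nbhs (x + s *: e_ i))); first exact: continuous_line.
  exact: continuous_green_integrand.
- split.
  + by move=> s _; have [] := dF s.
  + exact/cvg_at_right_filter/cF.
  + exact/cvg_at_left_filter/cF.
- by move=> s _; rewrite derive1E; have [_ ->] := dF s.
Qed.

(** Every line in direction [i] meets the ball in a chord. *)
Lemma ball_int_green_integrand (r : R) i f : 0 < r -> C2 f ->
  ball_int (green_integrand r i f) r = 0.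
Proof.
move=> r0 C2f; have cg : continuous (green_integrand r i f) by exact: continuous_green_integrand.
have mb := @measurable_tball R n r.
rewrite /ball_int Rintegral_mkcond /Rintegral.
set H := _ \_ _.
have [M M0 HM] := continuous_bounded_ball r cg.
rewrite (@integral_lines_eq0 _ _ i H M (r + 1))//.
- by rewrite ltr_wpDr.
- apply: (measurable_restrictT (green_integrand r i f \o vec) mb).1.
  exact: (measurable_funTS (measurable_continuous_vec cg)).
- move=> t; rewrite /H patchE; case: ifPn => [|_]; last by rewrite normr0.
  by rewrite inE => tr; exact: HM.
- move=> t tK; rewrite /H patchE; case: ifPn => // tr; case: tK => j.
  rewrite tnth_mktuple subr0 (@le_lt_trans _ _ r)// ?ltrDl//.
  move: tr; rewrite inE; apply: le_trans.
  by have := normr_coord_le_enorm (vec t) j; rewrite mxE.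
- move=> t; pose x := vec (set_coord t i 0).
  have xi : x 0 i = 0 by rewrite /x mxE tnth_mktuple eqxx.
  rewrite -[RHS](integral_green_chord r0 C2f xi) [RHS]integral_mkcond.
  apply: eq_integral => s _; rewrite /H !patchE vec_set_coord -/x.
  rewrite (_ : (set_coord t i s \in tball r) = (s \in [set s | enorm (x + s *: e_ i) <= r])).
    by case: ifP.
  by apply/idP/idP; rewrite !inE /tball/= vec_set_coord.
Qed.

Lemma ball_int_sum (F : 'I_n -> 'rV[R]_n -> R) r : (forall i, continuous (F i)) ->
  ball_int (fun x => \sum_(i < n) F i x) r = \sum_(i < n) ball_int (F i) r.
Proof.
move=> cF.
have H (s : seq 'I_n) : ball_int (fun x => \sum_(i <- s) F i x) r =
    \sum_(i <- s) ball_int (F i) r.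
  elim: s => [|i s IH].
    rewrite big_nil /ball_int -[RHS](mul0r (fine (leb (tball r)))).
    rewrite -Rintegral_cst; last exact: measurable_tball.
    by apply: eq_Rintegral => t _; rewrite big_nil.
  rewrite big_cons -IH -ball_intD//; last first.
    by apply: continuous_big => //; exact: (@add_continuous R^o).
  by rewrite /ball_int; apply: eq_Rintegral => t _; rewrite big_cons.
exact: H.
Qed.

Lemma continuous_laplacian f : C2 f -> continuous (laplacian f).
Proof.
move=> [_ C1f]; apply: continuous_big => [|i _]; first exact: (@add_continuous R^o).
by have [_ /(_ i)[]] := C1f i.
Qed.

(** On the sphere of radius [r] this is [r^2 f], which is why the powers of [r]
    in [green_ball] cancel when the identity is differentiated. *)
Definition sqr_times f x : R := enorm x ^+ 2 * f x.

Lemma continuous_sqr_times f : continuous f -> continuous (sqr_times f).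
Proof. by move=> cf; apply: continuousMf cf; exact: continuous_enorm_sqr. Qed.

(** The sum of [ball_int_green_integrand] over the coordinates, with the weight
    expanded in powers of [r] so that each term can be differentiated in [r]. *)
Lemma green_ball (r : R) f : 0 < r -> C2 f ->
  let L := laplacian f in
  r ^+ 4 * ball_int L r - 2 * r ^+ 2 * ball_int (sqr_times L) r
    + ball_int (sqr_times (sqr_times L)) r =
  (4 * n%:R + 8) * ball_int (sqr_times f) r - 4 * n%:R * r ^+ 2 * ball_int f r.
Proof.
move=> r0 C2f L; have cf : continuous f by case: C2f => -[].
have cL : continuous L by exact: continuous_laplacian.
have [cf1 cL1] := (continuous_sqr_times cf, continuous_sqr_times cL).
have cL2 := continuous_sqr_times cL1.
have cZ c g : continuous g -> continuous (fun x => c * g x).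
  by move=> cg; apply: continuousMf => //; exact: continuous_cst.
have : \sum_(i < n) ball_int (green_integrand r i f) r = 0.
  by apply: big1 => i _; exact: ball_int_green_integrand.
rewrite -ball_int_sum; last by move=> i; exact: continuous_green_integrand.
pose A x := r ^+ 4 * L x + ((- 2 * r ^+ 2) * sqr_times L x + sqr_times (sqr_times L) x).
pose B x := (- (4 * n%:R + 8)) * sqr_times f x + (4 * n%:R * r ^+ 2) * f x.
have -> : (fun x => \sum_(i < n) green_integrand r i f x) = (fun x => A x + B x).
  apply/funext => x; rewrite /green_integrand big_split/= -mulr_suml sumrN -mulr_sumr.
  rewrite -/(laplacian f x) -/(L x).
  have -> : \sum_(i < n) weight2 r i x =
      8 * enorm x ^+ 2 - n%:R * (4 * (r ^+ 2 - enorm x ^+ 2)).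
    rewrite /weight2 big_split/= -mulr_sumr -enorm_sqr sumrN sumr_const card_ord.
    by rewrite -[_ *+ n]mulr_natl.
  by rewrite /A /B /sqr_times /weight; ring.
rewrite ball_intD; last 2 first.
- by apply: continuousDf; [exact: cZ|apply: continuousDf => //; exact: cZ].
- by apply: continuousDf; exact: cZ.
rewrite ball_intD; [|exact: cZ|by apply: continuousDf => //; exact: cZ].
rewrite ball_intD//; last exact: cZ.
rewrite ball_intD; [|exact: cZ|exact: cZ].
rewrite !ball_intZ// => H.
by rewrite -[RHS]add0r -H; ring.
Qed.

End green_identity.

(** * The derivative of the spherical mean *)

Section sphere_mean_derivative.
Variables (R : realType) (n : nat).
Hypothesis n0 : (0 < n)%N.
Implicit Types (x y : 'rV[R]_n) (f g : 'rV[R]_n -> R) (r s : R).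

Lemma is_derive_invX k r : 0 < r ->
  is_derive r (1 : R) (fun s : R => (s ^+ k)^-1) (- k%:R * r ^+ k.-1 / (r ^+ k) ^+ 2).
Proof.
move=> r0; have rk : r ^+ k != 0 by rewrite expf_neq0// gt_eqF.
have [d1 d2] := is_derive_pow k r.
split; first exact: derivableV.
rewrite (@deriveV R R (fun s : R => s ^+ k) r 1 rk d1) d2 /GRing.scale/=.
by ring.
Qed.

Lemma sphere_int_sqr_times f r : 0 <= r -> continuous f ->
  sphere_int (sqr_times f) r = r ^+ 2 * sphere_int f r.
Proof.
move=> r0 cf; have cg : continuous (fun x => r ^+ 2 * f x).
  by apply: continuousMf => //; exact: continuous_cst.
rewrite (@eq_sphere_int _ _ _ (fun x => r ^+ 2 * f x))//.
- rewrite /sphere_int RintegralZl//; first exact: measurable_tball.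
  exact: (@integrable_radial R n f r 1 cf r0).
- exact: continuous_sqr_times.
- by move=> x xr; rewrite /sqr_times xr.
Qed.

Lemma sqr_times_ge0 f : (forall x, 0 <= f x) -> forall x, 0 <= sqr_times f x.
Proof. by move=> f0 x; rewrite mulr_ge0// sqr_ge0. Qed.

Section fixed_function.
Variable f : 'rV[R]_n -> R.
Hypotheses (C2f : C2 f) (f0 : forall x, 0 <= f x).
Let L := laplacian f.
Hypothesis L0 : forall x, 0 <= L x.

Let cf : continuous f. Proof. by case: C2f => -[]. Qed.
Let cL : continuous L. Proof. exact: continuous_laplacian. Qed.

(** The derivative in [r] of [green_ball], divided by [4 r]. *)
Lemma sphere_int_green r : 0 < r ->
  2 * n%:R * (r ^+ n * sphere_int f r - ball_int f r) =
  r ^+ 2 * ball_int L r - ball_int (sqr_times L) r.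
Proof.
move=> r0; pose g (h : 'rV[R]_n -> R) := n%:R * r ^+ n.-1 * sphere_int h r.
have dB (h : 'rV[R]_n -> R) : continuous h -> (forall x, 0 <= h x) -> is_derive r 1 (ball_int h) (g h).
  by move=> ch h0; exact: is_derive_ball_int.
have [cf1 cL1] := (continuous_sqr_times cf, continuous_sqr_times cL).
have [f10 L10] := (sqr_times_ge0 f0, sqr_times_ge0 L0).
have d1 := dB _ cf f0; have d2 := dB _ cf1 f10.
have d3 := dB _ cL L0; have d4 := dB _ cL1 L10.
have d5 := dB _ (continuous_sqr_times cL1) (sqr_times_ge0 L10).
pose lhs s := s ^+ 4 * ball_int L s - 2 * s ^+ 2 * ball_int (sqr_times L) s
  + ball_int (sqr_times (sqr_times L)) s.
pose rhs s := (4 * n%:R + 8) * ball_int (sqr_times f) s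
  - 4 * n%:R * s ^+ 2 * ball_int f s.
have dl : is_derive r 1 lhs (4 * r ^+ 3 * ball_int L r + r ^+ 4 * g L
   - (4 * r * ball_int (sqr_times L) r + 2 * r ^+ 2 * g (sqr_times L))
   + g (sqr_times (sqr_times L))).
  apply: is_derive_congr (is_deriveD (is_deriveB
    (is_deriveM (is_derive_pow 4 r) d3)
    (is_deriveZ 2 (is_deriveM (is_derive_pow 2 r) d4))) d5) _ _.
    by move=> s; rewrite !fctE/= /GRing.scale/= /lhs; ring.
  by rewrite ?fctE/= /GRing.scale/=; ring.
have dr : is_derive r 1 rhs ((4 * n%:R + 8) * g (sqr_times f)
   - (8 * n%:R * r * ball_int f r + 4 * n%:R * r ^+ 2 * g f)).
  apply: is_derive_congr (is_deriveB (is_deriveZ (4 * n%:R + 8) d2)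
    (is_deriveZ (4 * n%:R) (is_deriveM (is_derive_pow 2 r) d1))) _ _.
    by move=> s; rewrite !fctE/= /GRing.scale/= /rhs; ring.
  by rewrite ?fctE/= /GRing.scale/=; ring.
have E : \near r, lhs r = rhs r.
  by near=> s; apply: green_ball => //; near: s; exact: lt_nbhsr.
have [_ Er] := near_eq_is_derive E dl.
have [_ El] := dr; move: Er; rewrite El {El}.
rewrite /g !sphere_int_sqr_times ?(ltW r0)//.
have rn : r ^+ n = r * r ^+ n.-1 by rewrite -exprS prednK.
rewrite rn => Er; apply: (mulfI (_ : 4 * r != 0)).
  by rewrite mulf_neq0// gt_eqF.
set k := r ^+ n.-1 in Er *.
set a := ball_int _ _ in Er *; set b := sphere_int _ _ in Er *.
by apply/eqP; rewrite -subr_eq0; apply/eqP; move/eqP: Er; rewrite -subr_eq0 => /eqP Er; rewrite -[RHS]Er; ring.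
Unshelve. all: by end_near. Qed.

(** The divergence theorem for the gradient of [f]. Solving [sphere_int_green]
    for the spherical integral and differentiating once more avoids
    differentiating under the integral sign. *)
Lemma is_derive_sphere_int r : 0 < r ->
  is_derive r 1 (sphere_int f) (ball_int L r / (n%:R * r ^+ n.-1)).
Proof.
move=> r0; have nn : n%:R != 0 :> R by rewrite pnatr_eq0 -lt0n.
have cL1 := continuous_sqr_times cL; have L10 := sqr_times_ge0 L0.
have d1 := is_derive_ball_int cf f0 r0.
have d2 := is_derive_ball_int cL L0 r0.
have d3 := is_derive_ball_int cL1 L10 r0.
(* [sphere_int_green] solved for the spherical integral *)
pose Q s := ball_int f s + (2 * n%:R)^-1 * (s ^+ 2 * ball_int L s - ball_int (sqr_times L) s).
have dQ : is_derive r 1 Q (n%:R * r ^+ n.-1 * sphere_int f r + r * ball_int L r / n%:R).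
  apply: is_derive_congr (is_deriveD d1 (is_deriveZ (2 * n%:R)^-1
    (is_deriveB (is_deriveM (is_derive_pow 2 r) d2) d3))) _ _.
    by move=> s; rewrite !fctE/= /GRing.scale/= /Q; ring.
  rewrite ?fctE/= /GRing.scale/= (sphere_int_sqr_times (ltW r0))//.
  by field.
have QE s : 0 < s -> Q s = s ^+ n * sphere_int f s.
  move=> s0; rewrite /Q -sphere_int_green//; field.
  by [].
have E : \near r, ((fun s => (s ^+ n)^-1) * Q) r = sphere_int f r.
  near=> s; have s0 : 0 < s by near: s; exact: lt_nbhsr.
  by rewrite fctE QE// mulKf// expf_neq0// gt_eqF.
apply: near_eq_is_derive E _.
apply: is_derive_eq (is_deriveM (is_derive_invX n r0) dQ) _.
rewrite QE// /GRing.scale/=.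
have rn : r ^+ n = r * r ^+ n.-1 by rewrite -exprS prednK.
rewrite rn; field.
by rewrite nn expf_neq0 ?gt_eqF.
Unshelve. all: by end_near. Qed.

(** The mean over a ball is at most the mean over its boundary sphere. It is
    used to pass from positivity at one point to positivity of spherical
    means. *)
Lemma ball_int_le_sphere_int r : 0 < r -> ball_int f r <= r ^+ n * sphere_int f r.
Proof.
move=> r0; have nn : 0 < 2 * n%:R :> R by rewrite mulr_gt0// ltr0n.
rewrite -subr_ge0 -(pmulr_rge0 _ nn) sphere_int_green// subr_ge0.
have cL1 := continuous_sqr_times cL.
rewrite -ball_intZ//; apply: le_ball_int => //.
  by apply: continuousMf => //; exact: continuous_cst.
move=> x xr; rewrite /sqr_times ler_wpM2r// lerXn2r// ?nnegrE ?enorm_ge0//.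
exact: ltW.
Qed.

End fixed_function.
End sphere_mean_derivative.

(** * Hoelder's inequality on a sphere *)

Section weighted_mean.
Variables (R : realType) (n : nat).
Hypothesis n0 : (0 < n)%N.
Implicit Types (x y : 'rV[R]_n) (r s : R).
Local Notation vec := (@vec_of_tuple R n).
Local Notation leb := (@lebesgue_rn R n).
Local Notation tball := (@tball R n).

(** Bernoulli's inequality for real exponents, as Young's inequality with one
    factor equal to 1. *)
Lemma bernoulli_powR (t a : R) : 0 <= t -> 1 < a -> a * t <= t `^ a + (a - 1).
Proof.
move=> t0 a1; have a0 : 0 < a by rewrite (lt_trans _ a1).
have b0 : 0 < a / (a - 1) by rewrite divr_gt0// subr_gt0.
have ab : a^-1 + (a / (a - 1))^-1 = 1.
  by field; rewrite !gt_eqF// subr_gt0.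
have := conjugate_powR t0 (@ler01 R) a0 b0 ab.
rewrite mulr1 powR1 => H.
rewrite mulrC -ler_pdivlMr// (le_trans H)// mulrDl lerD2l.
by rewrite div1r invf_div.
Qed.

(** Tangent-plane inequality for the convex, 1-homogeneous function
    [(v, w) |-> v^a w^(1-a)], whose value at [w = P^(1/(1-a))] is [P v^a]. *)
Lemma tangent_powR (a k P v : R) : 1 < a -> 0 < k -> 0 <= P -> 0 <= v ->
  ((a * k `^ (a - 1) * v)%:E <=
   (P * v `^ a)%:E + ((a - 1) * k `^ a)%:E * neg_powR P (1 - a)^-1)%E.
Proof.
move=> a1 k0 P0 v0; have a10 : 0 < a - 1 by rewrite subr_gt0.
have c0 : 0 < (a - 1) * k `^ a by rewrite mulr_gt0// powR_gt0.
rewrite /neg_powR; case: eqVneq => [_|Pn0].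
  by rewrite mulry gtr0_sg// mul1e addey// leey.
have {}P0 : 0 < P by rewrite lt_neqAle eq_sym Pn0.
set w := P `^ _; have w0 : 0 < w by exact: powR_gt0.
rewrite -EFinM -EFinD lee_fin.
have t0 : 0 <= v / w / k by rewrite !divr_ge0// ltW.
have H := bernoulli_powR t0 a1.
have c1 : 0 <= w * k `^ a by rewrite mulr_ge0 ?powR_ge0// ltW.
have := ler_wpM2l c1 H.
have ka : k `^ a = k * k `^ (a - 1) by rewrite (mulr_powRB1 (ltW k0) (lt_trans ltr01 a1)).
have -> : w * k `^ a * (a * (v / w / k)) = a * k `^ (a - 1) * v.
  by rewrite ka; field; rewrite !gt_eqF.
rewrite mulrDr => /le_trans; apply; rewrite le_eqVlt; apply/orP; left; apply/eqP.
have -> : w * k `^ a * (v / w / k) `^ a = P * v `^ a.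
  have -> : P = w * w^-1 `^ a.
    rewrite -powR_inv1 ?ltW// -powRrM mulN1r -{1}(powRr1 (ltW w0)) -powRD; last first.
      by rewrite (gt_eqF w0) implybT.
    rewrite /w -powRrM mulVf ?powRr1 ?ltW//.
    by rewrite lt_eqF// subr_lt0.
  rewrite !powRM ?invr_ge0 ?mulr_ge0 ?invr_ge0 ?(ltW w0) ?(ltW k0)//.
  have kk : k `^ a * k^-1 `^ a = 1.
    by rewrite -powRM ?invr_ge0 ?(ltW k0)// divff ?powR1// gt_eqF.
  by rewrite -[RHS]mul1r -kk; ring.
by ring.
Qed.


Lemma sphere_intZ (c r : R) (f : 'rV[R]_n -> R) : 0 <= r -> continuous f ->
  sphere_int (fun x => c * f x) r = c * sphere_int f r.
Proof.
move=> r0 cf; rewrite /sphere_int RintegralZl//; first exact: measurable_tball.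
exact: (@integrable_radial R n f r 1 cf r0).
Qed.

Lemma sphere_int_EFin (r : R) (f : 'rV[R]_n -> R) : 0 <= r -> continuous f ->
  (\int[leb]_(t in tball 1) (f (radial r (vec t)))%:E = (sphere_int f r)%:E)%E.
Proof.
move=> r0 cf; rewrite /sphere_int fineK//; apply: integrable_fin_num.
  exact: measurable_tball.
exact: (@integrable_radial R n f r 1 cf r0).
Qed.

Lemma measurable_neg_powR (P : 'rV[R]_n -> R) e r : continuous P ->
  measurable_fun [set: n.-tuple (measurableTypeR R)]
    (fun t => neg_powR (P (radial r (vec t))) e).
Proof.
move=> cP; have mP := measurable_radial r cP.
rewrite /neg_powR; apply: measurable_fun_ifT.
- by apply: (measurable_fun_eqr mP); exact: measurable_cst.
- exact: measurable_cst.
- apply/measurable_EFinP.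
  by apply: (measurableT_comp (measurable_powR e)).
Qed.

Lemma neg_powR_ge0 (x e : R) : (0 <= neg_powR x e)%E.
Proof. by rewrite /neg_powR; case: ifP => // _; rewrite lee_fin powR_ge0. Qed.

Lemma sphere_areaE : @sphere_area R n = n%:R * ball_vol R n.
Proof.
rewrite /sphere_area /sphere_integral expr1n mul1r integral_cst; last first.
  exact: measurable_tball.
by rewrite mul1e [X in (_ * X)%E](@ball_volE R n).
Qed.

(** For [a > 1] this is Hoelder's inequality, obtained by integrating
    [tangent_powR] with [k] the ratio of the means of [v] and of [P^(1/(1-a))];
    that inequality holds trivially at the zeros of [P], where the weight is
    infinite, so no null set has to be discussed. For [a = 1] the infimum over
    the sphere is pulled out of the integral. *)
Lemma tilde_mul_mean_le (a r : R) (P v : 'rV[R]_n -> R) : 1 <= a -> 0 < r ->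
  continuous P -> continuous v -> continuous (fun x => P x * v x `^ a) ->
  (forall x, 0 <= P x) -> (forall x, 0 <= v x) ->
  tilde a P r * (sphere_int v r / ball_vol R n) `^ a <=
  sphere_int (fun x => P x * v x `^ a) r / ball_vol R n.
Proof.
move=> a1 r0 cP cv cg P0 v0; have k0 := ball_vol_gt0 R n.
set V := sphere_int v r / ball_vol R n.
have V0 : 0 <= V by rewrite divr_ge0 ?(ltW k0)// sphere_int_ge0.
have g0 x : 0 <= P x * v x `^ a by rewrite mulr_ge0// powR_ge0.
have m0 : 0 <= sphere_int (fun x => P x * v x `^ a) r / ball_vol R n.
  by rewrite divr_ge0 ?(ltW k0)// sphere_int_ge0.
rewrite /tilde; case: ltP => [a1'|a1']; last first.
  have {a1 a1'}-> : a = 1 by apply/eqP; rewrite eq_le a1' a1.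
  rewrite (powRr1 V0) /V mulrA; apply: ler_wpM2r; first by rewrite invr_ge0 ltW.
  set m := inf _; rewrite -sphere_intZ ?(ltW r0)//; apply: le_sphere_int => //.
  - exact: ltW.
  - by apply: continuousMf => //; exact: continuous_cst.
  - apply: continuousMf => // x.
    by under eq_fun do rewrite powRr1//; exact: cv.
  - move=> x xr; rewrite powRr1// ler_wpM2r//; apply: ge_inf; last by exists x.
    by exists 0 => _ [y _ <-].
have [->|Vn0] := eqVneq V 0.
  by rewrite powR0 ?mulr0// gt_eqF// (lt_trans ltr01).
have {Vn0}Vgt : 0 < V by rewrite lt_neqAle eq_sym Vn0.
set I := sphere_integral _ _; case: ifPn => [_|Ifin]; first by rewrite mul0r.
set w := fun x => neg_powR (P x) (1 - a)^-1.
pose J := (\int[leb]_(t in tball 1) w (radial r (vec t)))%E.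
have J0 : (0 <= J)%E by apply: integral_ge0 => t _; exact: neg_powR_ge0.
have cn : 0 < r ^+ n.-1 * n%:R by rewrite mulr_gt0 ?exprn_gt0 ?ltr0n.
have IJ : I = ((r ^+ n.-1 * n%:R)%:E * J)%E by [].
have Jfin : J \is a fin_num.
  rewrite ge0_fin_numE// ltey; apply: contraNneq Ifin => Joo.
  by rewrite IJ Joo mulry gtr0_sg// mul1e.
pose W := fine J / ball_vol R n.
have -> : (sphere_area R n * r ^+ n.-1)^-1 * fine I = W.
  rewrite IJ fineM// sphere_areaE /W/=; field.
  by rewrite !gt_eqF ?exprn_gt0 ?ltr0n.
have W0 : 0 <= W by rewrite divr_ge0 ?(ltW k0)// fine_ge0.
have [->|Wn0] := eqVneq W 0.
  by rewrite powR0 ?mul0r// lt_eqF// subr_lt0.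
have {Wn0}Wgt : 0 < W by rewrite lt_neqAle eq_sym Wn0.
(* the slope at which the tangent plane touches the means *)
pose k := V / W; have kgt : 0 < k by rewrite divr_gt0.
have me := @measurable_tball R n 1.
set g := fun x => P x * v x `^ a.
have key : ((a * k `^ (a - 1) * sphere_int v r)%:E <=
    (sphere_int g r)%:E + ((a - 1) * k `^ a * fine J)%:E)%E.
  have mg : measurable_fun (tball 1) (fun t => (g (radial r (vec t)))%:E).
    by apply: measurable_funTS; apply/measurable_EFinP; exact: measurable_radial.
  have mw : measurable_fun (tball 1) (fun t => w (radial r (vec t))).
    by apply: measurable_funTS; exact: measurable_neg_powR.
  have c0 : (0 <= ((a - 1) * k `^ a)%:E)%E.
    by rewrite lee_fin mulr_ge0 ?powR_ge0// subr_ge0.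
  rewrite -sphere_intZ ?(ltW r0)// -!sphere_int_EFin ?(ltW r0)//; last first.
    by apply: continuousMf => //; exact: continuous_cst.
  rewrite EFinM fineK// -ge0_integralZl//; last by move=> t _; exact: neg_powR_ge0.
  rewrite -ge0_integralD//; last 3 first.
  - by move=> t _; rewrite lee_fin; exact: g0.
  - by move=> t _; rewrite mule_ge0// neg_powR_ge0.
  - by apply: measurable_funeM.
  apply: ge0_le_integral => //.
  - move=> t _; rewrite lee_fin mulr_ge0// mulr_ge0 ?powR_ge0//.
    by rewrite (le_trans ler01).
  - apply: measurable_funTS; apply/measurable_EFinP.
    apply: (@measurable_radial R n (fun x => a * k `^ (a - 1) * v x) r).
    by apply: continuousMf => //; exact: continuous_cst.
  - by apply: emeasurable_funD => //; exact: measurable_funeM.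
  - by move=> t _; apply: tangent_powR.
move: key; rewrite -EFinD lee_fin.
have -> : sphere_int v r = ball_vol R n * V by rewrite /V mulrCA divff ?mulr1// gt_eqF.
have -> : fine J = ball_vol R n * W by rewrite /W mulrCA divff ?mulr1// gt_eqF.
have VkW : V = k * W by rewrite /k divfK// gt_eqF.
have ka : k `^ a = k * k `^ (a - 1).
  by rewrite (mulr_powRB1 (ltW kgt) (lt_trans ltr01 a1')).
have -> : W `^ (1 - a) * V `^ a = k `^ (a - 1) * V.
  have WW : W `^ (1 - a) * W `^ a = W.
    by rewrite -powRD ?(gt_eqF Wgt) ?implybT// subrK powRr1.
  by rewrite VkW powRM// ?(ltW kgt)// mulrCA WW ka; ring.
rewrite ler_pdivlMr// ka VkW => key.
rewrite -(lerD2r ((a - 1) * (k * k `^ (a - 1)) * (ball_vol R n * W))).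
by rewrite (le_trans _ key)// le_eqVlt; apply/orP; left; apply/eqP; ring.
Qed.

End weighted_mean.

(** * Superlinear recursions *)

Section blow_up.
Variable R : realType.
Implicit Types (t s h : R).

Lemma powR_exprn_comm (x y : R) (j : nat) : 0 <= x -> (x ^+ j) `^ y = (x `^ y) ^+ j.
Proof. by move=> x0; rewrite -(powR_mulrn _ x0) powRAC powR_mulrn ?powR_ge0. Qed.

Lemma expr_unbounded (m B : R) : 1 < m -> exists j, B < m ^+ j.
Proof.
move=> m1; have m0 : 0 < m - 1 by rewrite subr_gt0.
exists (Num.bound `|B / (m - 1)|).
set j := Num.bound _.
have Bj : B < j%:R * (m - 1).
  by rewrite -ltr_pdivrMr// (le_lt_trans (ler_norm _))// archi_boundP.
rewrite (lt_le_trans Bj)//.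
have H i : i%:R * (m - 1) <= m ^+ i - 1.
  elim: i => [|i IH]; first by rewrite mul0r expr0 subrr.
  rewrite exprS -natr1 mulrDl mul1r.
  have m1i : 1 <= m ^+ i by rewrite exprn_ege1// ltW.
  nra.
by rewrite (le_trans (H j))// gerBl.
Qed.

(** A superlinear recursion with at most geometrically decaying coefficients
    cannot stay bounded unless it starts small: otherwise its terms dominate
    the geometric sequence of ratio [M^(1/(g-1))]. *)
Lemma geometric_blow_up (M C g B : R) (z : nat -> R) :
  1 < g -> 1 < M -> 0 < C -> 0 < z 0%N ->
  (forall j, C / M ^+ j * z j `^ g <= z j.+1) -> (forall j, z j <= B) ->
  C * z 0%N `^ (g - 1) <= M `^ (g - 1)^-1.
Proof.
move=> g1 M1 C0 z0 zS zB; rewrite leNgt; apply/negP => large.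
(* the ratio at which the geometric decay is exactly compensated *)
set m := M `^ (g - 1)^-1 in large.
have M0 : 0 < M by exact: lt_trans M1.
have g0 : 0 < g - 1 by rewrite subr_gt0.
have m1 : 1 < m.
  rewrite /m /powR gt_eqF// expR_gt1 mulr_gt0 ?invr_gt0//.
  by rewrite ln_gt0.
have m0 : 0 < m by exact: lt_trans m1.
have mg : m `^ (g - 1) = M by rewrite /m -powRrM mulVf ?gt_eqF// powRr1// ltW.
have zm j : z 0%N * m ^+ j <= z j.
  elim: j => [|j IH]; first by rewrite expr0 mulr1.
  apply: le_trans (zS j).
  have zj0 : 0 <= z 0%N * m ^+ j by rewrite mulr_ge0 ?exprn_ge0 ?ltW.
  have Cj : 0 <= C / M ^+ j by rewrite divr_ge0 ?exprn_ge0 ?ltW.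
  have step : (z 0%N * m ^+ j) `^ g <= z j `^ g.
    by apply: ge0_ler_powR; rewrite ?nnegrE// ?(le_trans zj0 IH)// (le_trans ler01)// ltW.
  apply: le_trans (ler_wpM2l Cj step).
  rewrite -(mulr_powRB1 zj0); last by rewrite (lt_trans ltr01).
  rewrite powRM ?exprn_ge0 ?(ltW z0) ?(ltW m0)// powR_exprn_comm ?(ltW m0)// mg.
  have -> : C / M ^+ j * (z 0%N * m ^+ j * (z 0%N `^ (g - 1) * M ^+ j)) =
     z 0%N * m ^+ j * (C * z 0%N `^ (g - 1)).
    by field; rewrite expf_neq0// gt_eqF.
  rewrite exprSr mulrA ler_wpM2l//; exact: ltW.
have [j jB] := expr_unbounded (B / z 0%N) m1.
move: (le_trans (zm j) (zB j)); apply/negP; rewrite -ltNge.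
by rewrite mulrC -ltr_pdivrMr.
Qed.

(** The points [t + d (1 - 2^-j)] have increments [d / 2^(j+1)] and stay below
    [t + d], where [V] is finite: this provides the bound in
    [geometric_blow_up]. *)
Lemma dyadic_blow_up (M C g d t : R) (V : R -> R) :
  1 < g -> 1 < M -> 0 < C -> 0 < d -> 0 < V t ->
  (forall s s', t <= s -> s <= s' -> V s <= V s') ->
  (forall j s, t <= s -> s + d / 2 ^+ j.+1 <= t + d ->
    C / M ^+ j * V s `^ g <= V (s + d / 2 ^+ j.+1)) ->
  C * V t `^ (g - 1) <= M `^ (g - 1)^-1.
Proof.
move=> g1 M1 C0 d0 Vt Vmono step.
pose s j := t + d * (1 - (2 ^+ j)^-1).
have p2 j : 0 < 2 ^+ j :> R by rewrite exprn_gt0.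
have p1 j : (2 ^+ j)^-1 <= 1 :> R by rewrite invf_le1// exprn_ege1// ler1n.
have sS j : s j.+1 = s j + d / 2 ^+ j.+1.
  by rewrite /s exprS; field; rewrite gt_eqF.
have ts j : t <= s j by rewrite /s lerDl mulr_ge0 ?(ltW d0)// subr_ge0.
have sd j : s j <= t + d.
  by rewrite /s lerD2l ler_piMr ?(ltW d0)// gerBl invr_ge0 ltW.
have s0 : s 0%N = t by rewrite /s expr0 invr1 subrr mulr0 addr0.
have := @geometric_blow_up M C g (V (t + d)) (V \o s) g1 M1 C0.
rewrite /= s0; apply => // j.
  by rewrite sS; apply: step => //; rewrite -sS.
exact: Vmono.
Qed.

(** A positive nondecreasing [V] stays away from zero, which contradicts
    [dyadic_blow_up] once [C t] is large. *)
Lemma blow_up_vanish (M g T : R) (C d V : R -> R) :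
  1 < g -> 1 < M -> (forall t, 0 <= V t) ->
  (forall s s', T <= s -> s <= s' -> V s <= V s') ->
  (forall t, T <= t -> 0 < d t) -> (forall t, T <= t -> 0 < C t) ->
  (forall B t0, exists2 t, t0 <= t & B < C t) ->
  (forall t, T <= t -> forall j s, t <= s -> s + d t / 2 ^+ j.+1 <= t + d t ->
    C t / M ^+ j * V s `^ g <= V (s + d t / 2 ^+ j.+1)) ->
  forall t, T <= t -> V t = 0.
Proof.
move=> g1 M1 V0 Vmono d0 C0 Coo step t0 Tt0; apply/eqP; apply: contraT => Vn.
have Vt0 : 0 < V t0 by rewrite lt_neqAle eq_sym Vn V0.
have g0 : 0 < g - 1 by rewrite subr_gt0.
have vp : 0 < V t0 `^ (g - 1) by rewrite powR_gt0.
have [t t0t Ct] := Coo (M `^ (g - 1)^-1 / V t0 `^ (g - 1)) t0.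
have Tt := le_trans Tt0 t0t.
have Vtt : V t0 <= V t by exact: Vmono.
have := @dyadic_blow_up M (C t) g (d t) t V g1 M1 (C0 _ Tt) (d0 _ Tt)
  (lt_le_trans Vt0 Vtt) _ (step _ Tt).
move=> /(_ _)/wrap[s s' ts ss'|]; first by apply: Vmono => //; exact: le_trans ts.
apply: contraTT => _; rewrite -ltNge.
move: Ct; rewrite ltr_pdivrMr// => /lt_le_trans; apply.
rewrite ler_wpM2l ?(ltW (C0 _ Tt))//.
by apply: ge0_ler_powR; rewrite ?nnegrE ?(ltW g0).
Qed.

End blow_up.

(** * Estimates for real powers and increments *)

Section growth.
Variable R : realType.
Implicit Types (t s h : R).

Lemma powR_ratio_ge (q s s' x : R) : 0 < s -> s <= s' -> s' <= q * s ->
  q `^ (- `|x|) * s `^ x <= s' `^ x.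
Proof.
move=> s0 ss' s'q; have s'0 : 0 < s' by exact: lt_le_trans ss'.
have q1 : 1 <= q by rewrite -(ler_pM2r s0) mul1r (le_trans ss').
have q0 : 0 < q by exact: lt_le_trans q1.
have rho : s' = s' / s * s by rewrite divfK// gt_eqF.
have r1 : 1 <= s' / s by rewrite ler_pdivlMr// mul1r.
have rq : s' / s <= q by rewrite ler_pdivrMr.
have r0 : 0 < s' / s by exact: lt_le_trans r1.
rewrite [in leRHS]rho powRM ?(ltW r0) ?(ltW s0)// ler_wpM2r ?powR_ge0//.
rewrite /powR !gt_eqF// ler_expR mulNr lerNl.
apply: (@le_trans _ _ `|x * ln (s' / s)|); first by rewrite ler_normr lexx orbT.
have l0 : 0 <= ln (s' / s) by rewrite ln_ge0.
by rewrite normrM (ger0_norm l0) ler_wpM2l// ler_ln.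
Qed.

Lemma powR_unbounded (e B t0 : R) : 0 < e -> exists2 t, t0 <= t & B < t `^ e.
Proof.
move=> e0; pose b := `|B| + 1; have b0 : 0 < b by rewrite ltr_wpDl.
exists (Num.max t0 (b `^ e^-1)); first by rewrite le_max lexx.
rewrite (lt_le_trans (_ : _ < b))//.
  by rewrite /b (le_lt_trans (ler_norm _))// ltrDl.
rewrite -[leLHS](powRr1 (ltW b0)) -(mulVf (lt0r_neq0 e0)) powRrM.
apply: ge0_ler_powR; rewrite ?nnegrE ?powR_ge0 ?(ltW e0)//.
  by rewrite le_max powR_ge0 orbT.
by rewrite le_max lexx orbT.
Qed.

(** From [e^x >= (1 + x / m)^m] with [m] at least [1 - w]. *)
Lemma expR_powR_unbounded (th w B t0 : R) : 0 < th ->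
  exists2 t, t0 <= t & B < expR (th * t) * t `^ w.
Proof.
move=> th0.
pose m := (Num.bound `|w|).+2.
have m0 : 0 < m%:R :> R by rewrite ltr0n.
have mw : 1 <= w + m%:R.
  have wb : `|w| < (Num.bound `|w|)%:R by rewrite archi_boundP.
  have : - w <= `|w| by rewrite ler_normr lexx orbT.
  by rewrite /m -natr1 -natr1 => ?; lra.
pose c := (th / m%:R) ^+ m.
have c0 : 0 < c by rewrite exprn_gt0// divr_gt0.
pose t := Num.max (Num.max t0 1) (`|B| / c + 1).
have t1 : 1 <= t by rewrite /t !le_max lexx orbT.
have tp : 0 < t by exact: lt_le_trans t1.
exists t; first by rewrite /t !le_max lexx.
have E1 : c * t ^+ m <= expR (th * t).
  have -> : th * t = m%:R * (th * t / m%:R) by field; rewrite gt_eqF.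
  rewrite expRM_natl /c -exprMn lerXn2r// ?nnegrE ?expR_ge0//.
    by rewrite mulr_ge0 ?divr_ge0 ?(ltW th0) ?(ltW tp).
  apply: le_trans (expR_ge1Dx _).
  by rewrite (_ : th / m%:R * t = th * t / m%:R) ?lerDr//; ring.
have E2 : t <= t ^+ m * t `^ w.
  rewrite -powR_mulrn ?(ltW tp)// -powRD; last by rewrite (gt_eqF tp) implybT.
  by rewrite addrC -[leLHS]powRr1 ?(ltW tp)// ler_powR.
apply: (@lt_le_trans _ _ (c * t)).
  rewrite mulrC -ltr_pdivrMr//.
  apply: (@lt_le_trans _ _ (`|B| / c + 1)); last by rewrite /t le_max lexx orbT.
  by rewrite ltr_pwDr// ler_wpM2r ?invr_ge0 ?(ltW c0)// ler_norm.
apply: (@le_trans _ _ (c * (t ^+ m * t `^ w))); first by rewrite ler_wpM2l ?(ltW c0).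
by rewrite mulrA ler_wpM2r// powR_ge0.
Qed.

(** Increments of order [h^e] on steps [h <= 1] add up, over a longer step, to an
    increment linear in its length. On a step of length [t * rho] the bound
    [t * rho^e] is, up to a factor 2, valid in both regimes. *)
Lemma chain_increments (W : R -> R) (a e s t rho : R) :
  0 <= a -> 1 <= e -> 1 <= t -> 0 < rho -> rho <= 1 ->
  (forall x y, s <= x -> x <= y -> W x <= W y) ->
  (forall x h, s <= x -> 0 < h -> h <= 1 -> x + h <= s + t * rho ->
     W x + a * h `^ e <= W (x + h)) ->
  W s + a / 2 * (t * rho `^ e) <= W (s + t * rho).
Proof.
move=> a0 e1 t1 r0 r1 Wmono step; have t0 : 0 < t by exact: lt_le_trans t1.
have re0 : 0 <= t * rho `^ e by rewrite mulr_ge0 ?powR_ge0 ?ltW.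
have rre : rho `^ e <= rho by rewrite ge1r_powR ?r0.
have [small|large] := leP (t * rho) 1.
  apply: le_trans (step s (t * rho) _ _ _ _) => //; last by rewrite mulr_gt0.
  rewrite lerD2l powRM ?(ltW t0) ?(ltW r0)//.
  have te : t <= t `^ e by rewrite le1r_powR.
  have : a / 2 * (t * rho `^ e) <= a * (t * rho `^ e) by nra.
  move=> /le_trans; apply; rewrite ler_wpM2l// ler_wpM2r ?powR_ge0//.
pose n := Num.truncn (t * rho).
have /andP[nl nu] : n%:R <= t * rho < n.+1%:R.
  by apply: truncn_itv; rewrite mulr_ge0 ?ltW.
have chain k : (k <= n)%N -> W s + k%:R * a <= W (s + k%:R).
  elim: k => [|k IH] kn; first by rewrite mul0r !addr0.
  have kn' : k.+1%:R <= n%:R :> R by rewrite ler_nat.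
  have := step (s + k%:R) 1; rewrite lerDl ler0n lexx ltr01 powR1 mulr1.
  rewrite -addrA natr1 lerD2l (le_trans kn' nl) => /(_ isT isT isT isT).
  have := IH (ltnW kn); rewrite -natr1; lra.
apply: le_trans (Wmono (s + n%:R) _ _ _); last 2 first.
- by rewrite lerDl.
- by rewrite lerD2l.
apply: le_trans (chain n (leqnn n)); rewrite lerD2l.
have n1 : 1 <= n%:R :> R.
  have : (0 < n)%N by rewrite -ltnS -(ltr_nat R); exact: lt_trans nu.
  by rewrite ler1n.
have trt : t * rho `^ e <= t * rho by rewrite ler_wpM2l ?(ltW t0).
have : t * rho <= n%:R + 1 by rewrite natr1 ltW.
nra.
Qed.

End growth.

(** * Coupled growth inequalities *)

Section system.
Variable R : realType.
Variables (k l nu xi a b c T : R) (U V : R -> R).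
Hypotheses (a1 : 1 <= a) (b1 : 1 <= b) (ab1 : 1 < a * b) (c0 : 0 < c) (T1 : 1 <= T).
Hypotheses (U0 : forall t, 0 <= U t) (V0 : forall t, 0 <= V t).
Hypothesis Umono : forall s s', T <= s -> s <= s' -> U s <= U s'.
Hypothesis Vmono : forall s s', T <= s -> s <= s' -> V s <= V s'.
Hypothesis HU : forall t h, T <= t -> 0 < h -> h <= 1 ->
  U t + c * (expR (k * t) * t `^ (- nu)) * h ^+ 2 * V t `^ a <= U (t + h).
Hypothesis HV : forall t h, T <= t -> 0 < h -> h <= 1 ->
  V t + c * (expR (l * t) * t `^ (- xi)) * h ^+ 2 * U t `^ b <= V (t + h).

Let b0 : 0 < b. Proof. exact: lt_le_trans b1. Qed.
Let e := 2 + 2 * b.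
Let e1 : 1 <= e. Proof. by rewrite /e; have := b0; lra. Qed.
Let e0 : 0 < e. Proof. exact: lt_le_trans e1. Qed.
Let M := 2 `^ e.

Let M1 : 1 < M.
Proof.
rewrite /M /powR gt_eqF// expR_gt1 mulr_gt0//.
by rewrite ln_gt0// ltr1n.
Qed.

Let M0 : 0 < M. Proof. exact: lt_trans M1. Qed.

Let half_pow j : (2 ^+ j)^-1 `^ e = (M ^+ j)^-1.
Proof.
rewrite -exprVn powR_exprn_comm ?invr_ge0// -exprVn; congr (_ ^+ _).
by rewrite /M -powR_inv1// -powRrM mulN1r powRN.
Qed.

Let half_le1 j : (2 ^+ j)^-1 <= 1 :> R.
Proof. by rewrite invf_le1 ?exprn_gt0// exprn_ege1// ler1n. Qed.

Let half_gt0 j : 0 < (2 ^+ j)^-1 :> R.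
Proof. by rewrite invr_gt0 exprn_gt0. Qed.

Let th := l + b * k.
Let om := xi + b * nu.

(** Feeding the increment of [U] over a half step into that of [V]. *)
Lemma two_step : exists2 kap, 0 < kap & forall s h, T <= s -> 0 < h -> h <= 1 ->
  V s + kap * (expR (th * s) * s `^ (- om)) * h `^ e * V s `^ (a * b) <= V (s + h + h).
Proof.
pose kap := c * (expR (- `|l|) * 2 `^ (- `|- xi|)) * c `^ b.
exists kap; first by rewrite !mulr_gt0 ?expR_gt0 ?powR_gt0.
move=> s h Ts h0 h1; have s1 : 1 <= s by exact: le_trans Ts.
have s0 : 0 < s by exact: lt_le_trans s1.
have Tsh : T <= s + h by rewrite (le_trans Ts)// lerDl ltW.
apply: le_trans (HV Tsh h0 h1).
apply: lerD; first by apply: Vmono => //; rewrite lerDl ltW.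
set A := c * (expR (k * s) * s `^ (- nu)) * h ^+ 2 * V s `^ a.
have h2 : 0 <= h ^+ 2 by exact: sqr_ge0.
have A0 : 0 <= A by rewrite !mulr_ge0 ?expR_ge0 ?powR_ge0 ?ltW.
have AU : A `^ b <= U (s + h) `^ b.
  apply: ge0_ler_powR; rewrite ?nnegrE ?(ltW b0)//.
  by apply: le_trans (HU Ts h0 h1); rewrite lerDr.
have Ab : A `^ b = c `^ b * (expR (b * k * s) * s `^ (- (b * nu)) * h `^ (2 * b) * V s `^ (a * b)).
  rewrite /A !powRM ?mulr_ge0 ?expR_ge0 ?powR_ge0 ?(ltW c0) ?(ltW h0)//.
  rewrite [V s `^ (a * b)]powRrM.
  have -> : h `^ (2 * b) = h `^ b * h `^ b.
    by rewrite -powRD ?(gt_eqF h0) ?implybT// -mulr2n mulr_natl.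
  have -> : expR (k * s) `^ b = expR (b * k * s).
    by rewrite /powR gt_eqF ?expR_gt0// expRK mulrA.
  have -> : (s `^ (- nu)) `^ b = s `^ (- (b * nu)).
    by rewrite -powRrM mulNr [nu * b]mulrC.
  by ring.
have sx : 2 `^ (- `|- xi|) * s `^ (- xi) <= (s + h) `^ (- xi).
  by apply: powR_ratio_ge => //; [rewrite lerDl ltW|lra].
have lx : expR (- `|l|) * expR (l * s) <= expR (l * (s + h)).
  rewrite -expRD ler_expR mulrDr [leLHS]addrC lerD2l.
  rewrite lerNl; apply: (@le_trans _ _ `|l * h|); first by rewrite -normrN ler_norm.
  by rewrite normrM (gtr0_norm h0) ler_piMr.
have -> : kap * (expR (th * s) * s `^ (- om)) * h `^ e * V s `^ (a * b) =
    c * ((expR (- `|l|) * expR (l * s)) * (2 `^ (- `|- xi|) * s `^ (- xi))) * h ^+ 2 * A `^ b.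
  have -> : expR (th * s) = expR (l * s) * expR (b * k * s).
    by rewrite -expRD; congr expR; rewrite /th; ring.
  have -> : s `^ (- om) = s `^ (- xi) * s `^ (- (b * nu)).
    by rewrite -powRD ?(gt_eqF s0) ?implybT// /om opprD.
  have -> : h `^ e = h ^+ 2 * h `^ (2 * b).
    by rewrite -powR_mulrn ?(ltW h0)// -powRD ?(gt_eqF h0) ?implybT// /e.
  by rewrite Ab /kap; ring.
apply: ler_pM => //; first by rewrite !mulr_ge0 ?expR_ge0 ?powR_ge0 ?ltW.
  exact: powR_ge0.
rewrite ler_wpM2r// ler_wpM2l ?(ltW c0)//.
by apply: ler_pM => //; rewrite mulr_ge0 ?expR_ge0 ?powR_ge0.
Qed.

(** Intervals of length 2: the dyadic steps [2 / 2^(j+1)] are then twice a step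
    [h <= 1], as [two_step] requires. *)
Lemma vanish_supercritical : 0 < th -> forall t, T <= t -> V t = 0.
Proof.
move=> th0; have [kap kap0 step2] := two_step.
pose C t := kap * 3 `^ (- `|- om|) / M * (expR (th * t) * t `^ (- om)).
have K0 : 0 < kap * 3 `^ (- `|- om|) / M by rewrite divr_gt0// mulr_gt0 ?powR_gt0.
apply: (@blow_up_vanish R M (a * b) T C (fun=> 2) V) => //.
- by move=> t Tt; rewrite /C mulr_gt0// mulr_gt0 ?expR_gt0 ?powR_gt0// (lt_le_trans ltr01)// (le_trans T1).
- move=> B t0.
  have [t t0t Bt] := expR_powR_unbounded (- om) (B / (kap * 3 `^ (- `|- om|) / M)) t0 th0.
  by exists t => //; rewrite /C mulrC -ltr_pdivrMr.
move=> t Tt j s ts sd.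
have t1 : 1 <= t := le_trans T1 Tt.
have t0 : 0 < t := lt_le_trans ltr01 t1.
have Ts : T <= s := le_trans Tt ts.
pose h : R := (2 ^+ j.+1)^-1.
have hh : s + 2 / 2 ^+ j.+1 = s + h + h by rewrite /h; ring.
rewrite hh; apply: le_trans (step2 s h Ts (half_gt0 _) (half_le1 _)).
apply: (@le_trans _ _ (kap * (expR (th * s) * s `^ (- om)) * h `^ e * V s `^ (a * b))); last first.
  by rewrite lerDr.
rewrite ler_wpM2r ?powR_ge0// /h half_pow /C exprS.
have st3 : s <= 3 * t.
  have : 0 <= 2 / 2 ^+ j.+1 :> R by rewrite divr_ge0// exprn_ge0.
  lra.
have H1 : 3 `^ (- `|- om|) * t `^ (- om) <= s `^ (- om) by exact: powR_ratio_ge.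
have H2 : expR (th * t) <= expR (th * s) by rewrite ler_expR ler_wpM2l// ltW.
have -> : kap * 3 `^ (- `|- om|) / M * (expR (th * t) * t `^ (- om)) / M ^+ j =
  kap * (expR (th * t) * (3 `^ (- `|- om|) * t `^ (- om))) / (M * M ^+ j).
  by field; rewrite expf_neq0 gt_eqF.
rewrite ler_wpM2r ?invr_ge0 ?mulr_ge0 ?exprn_ge0 ?(ltW M0)//.
rewrite ler_wpM2l ?(ltW kap0)//.
by apply: ler_pM => //; rewrite ?expR_ge0// mulr_ge0 ?powR_ge0.
Qed.

(** Here the exponential factors of the two inequalities cancel, so that a step
    of [two_step] can be repeated: on an interval of length [t] this produces
    the factor [t * t^(- om)]. *)
Lemma vanish_critical : th = 0 -> om < 1 -> forall t, T <= t -> V t = 0.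
Proof.
move=> thE om1; have [kap kap0 step2] := two_step.
pose K := kap * 2 `^ (- `|- om|) / M / 2 / M.
have K0 : 0 < K by rewrite !divr_gt0// mulr_gt0 ?powR_gt0.
pose C t := K * t `^ (1 - om).
apply: (@blow_up_vanish R M (a * b) T C id V) => //.
- by move=> t Tt; rewrite (lt_le_trans ltr01)// (le_trans T1).
- by move=> t Tt; rewrite /C mulr_gt0// powR_gt0// (lt_le_trans ltr01)// (le_trans T1).
- move=> B t0; have p : 0 < 1 - om by rewrite subr_gt0.
  have [t t0t Bt] := powR_unbounded (B / K) t0 p.
  by exists t => //; rewrite /C mulrC -ltr_pdivrMr.
move=> t Tt j s ts sd.
have t1 : 1 <= t := le_trans T1 Tt.
have t0 : 0 < t := lt_le_trans ltr01 t1.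
have Ts : T <= s := le_trans Tt ts.
set A := kap * 2 `^ (- `|- om|) * t `^ (- om) / M * V s `^ (a * b).
have A0 : 0 <= A by rewrite !mulr_ge0 ?invr_ge0 ?powR_ge0 ?(ltW kap0)// ltW.
have := @chain_increments R V A e s t (2 ^+ j.+1)^-1 A0 e1 t1 (half_gt0 _) (half_le1 _).
move=> /(_ _ _)/wrap[x y sx|x h sx h0 h1 xh|].
- by apply: Vmono; exact: le_trans sx.
- have Tx : T <= x by exact: le_trans sx.
  have h20 : 0 < h / 2 by rewrite divr_gt0.
  have h21 : h / 2 <= 1 by lra.
  have := step2 x (h / 2) Tx h20 h21.
  rewrite thE mul0r expR0 mul1r -addrA -splitr => /(le_trans _); apply.
  rewrite lerD2l.
  have -> : (h / 2) `^ e = h `^ e / M.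
    rewrite powRM ?(ltW h0) ?invr_ge0//; congr (_ * _).
    by have := half_pow 1; rewrite !expr1.
  have x0 : 0 <= x by rewrite (le_trans (ltW t0))// (le_trans ts).
  have H1 : 2 `^ (- `|- om|) * t `^ (- om) <= x `^ (- om).
    by apply: powR_ratio_ge => //; [exact: le_trans sx|lra].
  have H2 : V s `^ (a * b) <= V x `^ (a * b).
    apply: ge0_ler_powR; rewrite ?nnegrE//; last exact: Vmono.
    by rewrite (le_trans ler01)// ltW.
  have -> : A * h `^ e = kap * (2 `^ (- `|- om|) * t `^ (- om)) * (h `^ e / M) * V s `^ (a * b).
    by rewrite /A; ring.
  have hM : 0 <= h `^ e / M by rewrite divr_ge0 ?powR_ge0 ?ltW.
  apply: ler_pM => //; first by rewrite mulr_ge0// !mulr_ge0 ?powR_ge0 ?(ltW kap0).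
    exact: powR_ge0.
  by rewrite ler_wpM2r// ler_wpM2l// ltW.
rewrite half_pow; apply: le_trans.
apply: (@le_trans _ _ (A / 2 * (t / M ^+ j.+1))); last by rewrite lerDr.
rewrite le_eqVlt; apply/orP; left; apply/eqP.
rewrite /C; have -> : t `^ (1 - om) = t * t `^ (- om).
  by rewrite powRD ?(gt_eqF t0) ?implybT// powRr1// ltW.
by rewrite /A /K exprS; field; rewrite expf_neq0 gt_eqF.
Qed.

(** Without exponential factors each inequality can be chained separately over
    an interval of length comparable to [t] before they are composed; this
    gains the factor [t^(1 - nu)] for [U], raised to the power [b], and
    [t^(1 - xi)] for [V]. *)
Lemma vanish_logarithmic : k = 0 -> l = 0 -> 0 < 1 - xi + b * (1 - nu) ->
  forall t, T <= t -> V t = 0.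
Proof.
move=> k0 l0 sig0; pose sig := 1 - xi + b * (1 - nu).
pose KU := c * 2 `^ (- `|- nu|) / 2.
pose KV := c * 2 `^ (- `|- xi|) / 2.
have KU0 : 0 < KU by rewrite divr_gt0// mulr_gt0 ?powR_gt0.
have KV0 : 0 < KV by rewrite divr_gt0// mulr_gt0 ?powR_gt0.
pose K := KV * KU `^ b / M ^+ 2.
have K0 : 0 < K by rewrite divr_gt0 ?exprn_gt0// mulr_gt0 ?powR_gt0.
pose C t := K * t `^ sig.
apply: (@blow_up_vanish R M (a * b) T C id V) => //.
- by move=> t Tt; rewrite (lt_le_trans ltr01)// (le_trans T1).
- by move=> t Tt; rewrite /C mulr_gt0// powR_gt0// (lt_le_trans ltr01)// (le_trans T1).
- move=> B t0.
  have [t t0t Bt] := powR_unbounded (B / K) t0 sig0.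
  by exists t => //; rewrite /C mulrC -ltr_pdivrMr.
move=> t Tt j s ts sd.
have t1 : 1 <= t := le_trans T1 Tt.
have t0 : 0 < t := lt_le_trans ltr01 t1.
have Ts : T <= s := le_trans Tt ts.
(* half of the dyadic step: one half for [U], one half for [V] *)
pose rho : R := (2 ^+ j.+2)^-1.
have r0 : 0 < rho := half_gt0 _.
have sE : s + t / 2 ^+ j.+1 = s + t * rho + t * rho.
  by rewrite /rho [2 ^+ j.+2]exprS; field; rewrite expf_neq0 ?pnatr_eq0.
have s't : s <= s + t * rho by rewrite lerDl mulr_ge0 ?ltW.
rewrite sE in sd *.
have tr0 : 0 <= t * rho by rewrite mulr_ge0 ?ltW.
have e21 : 1 <= 2%:R :> R by rewrite ler1n.
pose aU := c * (2 `^ (- `|- nu|) * t `^ (- nu)) * V s `^ a.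
have aU0 : 0 <= aU by rewrite !mulr_ge0 ?powR_ge0 ?ltW.
have stepU : aU / 2 * (t * rho ^+ 2) <= U (s + t * rho).
  have := @chain_increments R U aU 2%:R s t rho aU0 e21 t1 r0 (half_le1 _).
  move=> /(_ _ _)/wrap[x y sx|x h sx h0 h1 xh|].
  - by apply: Umono; exact: le_trans sx.
  - have Tx : T <= x by exact: le_trans sx.
    apply: le_trans (HU Tx h0 h1); rewrite lerD2l k0 mul0r expR0 mul1r.
    rewrite powR_mulrn ?(ltW h0)//.
    have H1 : 2 `^ (- `|- nu|) * t `^ (- nu) <= x `^ (- nu).
      by apply: powR_ratio_ge => //; [exact: le_trans sx|lra].
    have H2 : V s `^ a <= V x `^ a.
      by apply: ge0_ler_powR; rewrite ?nnegrE ?(le_trans ler01 a1)//; exact: Vmono.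
    have -> : aU * h ^+ 2 = c * (2 `^ (- `|- nu|) * t `^ (- nu)) * h ^+ 2 * V s `^ a.
      by rewrite /aU; ring.
    apply: ler_pM => //.
    + by rewrite mulr_ge0 ?sqr_ge0// !mulr_ge0 ?powR_ge0 ?(ltW c0).
    + exact: powR_ge0.
    + by rewrite ler_wpM2r ?sqr_ge0// ler_wpM2l// ltW.
  rewrite powR_mulrn ?(ltW r0)//; apply: le_trans.
  by rewrite lerDr.
have Ts' : T <= s + t * rho := le_trans Ts s't.
pose aV := c * (2 `^ (- `|- xi|) * t `^ (- xi)) * U (s + t * rho) `^ b.
have aV0 : 0 <= aV by rewrite !mulr_ge0 ?powR_ge0 ?ltW.
have stepV : aV / 2 * (t * rho ^+ 2) <= V (s + t * rho + t * rho).
  have := @chain_increments R V aV 2%:R (s + t * rho) t rho aV0 e21 t1 r0 (half_le1 _).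
  move=> /(_ _ _)/wrap[x y sx|x h sx h0 h1 xh|].
  - by apply: Vmono; exact: le_trans sx.
  - have Tx : T <= x by exact: le_trans sx.
    apply: le_trans (HV Tx h0 h1); rewrite lerD2l l0 mul0r expR0 mul1r.
    rewrite powR_mulrn ?(ltW h0)//.
    have H1 : 2 `^ (- `|- xi|) * t `^ (- xi) <= x `^ (- xi).
      by apply: powR_ratio_ge => //; lra.
    have H2 : U (s + t * rho) `^ b <= U x `^ b.
      by apply: ge0_ler_powR; rewrite ?nnegrE ?(ltW b0)//; exact: Umono.
    have -> : aV * h ^+ 2 = c * (2 `^ (- `|- xi|) * t `^ (- xi)) * h ^+ 2 * U (s + t * rho) `^ b.
      by rewrite /aV; ring.
    apply: ler_pM => //.
    + by rewrite mulr_ge0 ?sqr_ge0// !mulr_ge0 ?powR_ge0 ?(ltW c0).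
    + exact: powR_ge0.
    + by rewrite ler_wpM2r ?sqr_ge0// ler_wpM2l// ltW.
  rewrite powR_mulrn ?(ltW r0)//; apply: le_trans.
  by rewrite lerDr.
apply: le_trans stepV.
set A := aU / 2 * (t * rho ^+ 2) in stepU.
have A0 : 0 <= A.
  by rewrite /A mulr_ge0//; [rewrite divr_ge0|rewrite mulr_ge0 ?sqr_ge0// ltW].
have AU : A `^ b <= U (s + t * rho) `^ b.
  by apply: ge0_ler_powR; rewrite ?nnegrE ?(ltW b0).
have AE : A `^ b = KU `^ b * t `^ (b * (1 - nu)) * rho `^ (2 * b) * V s `^ (a * b).
  have -> : A = KU * t `^ (1 - nu) * rho `^ 2%:R * V s `^ a.
    rewrite powR_mulrn ?(ltW r0)// powRD ?(gt_eqF t0) ?implybT// powRr1 ?(ltW t0)//.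
    by rewrite /A /aU /KU; ring.
  rewrite !powRM ?mulr_ge0 ?powR_ge0 ?(ltW KU0) ?(ltW c0)//.
  by rewrite -!powRrM [(1 - nu) * b]mulrC.
have -> : aV / 2 * (t * rho ^+ 2) =
    KV * t `^ (1 - xi) * rho `^ 2%:R * U (s + t * rho) `^ b.
  rewrite powR_mulrn ?(ltW r0)// powRD ?(gt_eqF t0) ?implybT// powRr1 ?(ltW t0)//.
  by rewrite /aV /KV; ring.
apply: le_trans (_ : KV * t `^ (1 - xi) * rho `^ 2%:R * A `^ b <= _); last first.
  apply: ler_wpM2l => //; apply: mulr_ge0; last exact: powR_ge0.
  by apply: mulr_ge0; [exact: ltW|exact: powR_ge0].
rewrite le_eqVlt; apply/orP; left; apply/eqP.
have -> : C t / M ^+ j = KV * KU `^ b * t `^ sig * (M ^+ j.+2)^-1.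
  by rewrite /C /K !exprS expr0; field; rewrite expf_neq0 gt_eqF.
rewrite -half_pow -/rho AE /sig.
have -> : t `^ (1 - xi + b * (1 - nu)) = t `^ (1 - xi) * t `^ (b * (1 - nu)).
  by rewrite powRD ?(gt_eqF t0) ?implybT.
have -> : rho `^ e = rho `^ 2%:R * rho `^ (2 * b).
  by rewrite -powRD ?(gt_eqF r0) ?implybT.
by ring.
Qed.

End system.

(** * Spherical means in the logarithmic variable *)

Section means_growth.
Variables (R : realType) (n : nat).
Hypothesis n2 : (2 <= n)%N.
Let n0 : (0 < n)%N. Proof. exact: leq_trans n2. Qed.
Implicit Types (f : 'rV[R]_n -> R) (h r : R).
Local Notation vec := (@vec_of_tuple R n).
Local Notation leb := (@lebesgue_rn R n).

(** The ball eventually contains a box on which [f] exceeds half its value at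
    [x0]. *)
Lemma ball_int_gt0 f (x0 : 'rV[R]_n) : continuous f -> (forall x, 0 <= f x) -> 0 < f x0 ->
  exists r0, forall r, r0 <= r -> 0 < ball_int f r.
Proof.
move=> cf f0 fx0; have f2 : f x0 / 2 < f x0 by lra.
have nb : \forall x \near x0, f x0 / 2 < f x by apply: (cvgr_gt _ (cf x0)).
have /nbhs_ballP[d /= d0 dP] := nb.
pose c : n.-tuple (measurableTypeR R) := [tuple x0 0 i | i < n].
have [r0 [r00 sub]] := @box_sub_ball R n c d (ltW d0).
exists r0 => r r0r.
have boxP (t : n.-tuple (measurableTypeR R)) : box c d t -> f x0 / 2 <= f (vec t).
  move=> td; apply/ltW/dP; split => // i j; rewrite (ord1 i) mxE /ball/=.
  by have := td j; rewrite tnth_mktuple distrC.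
have subr : box c d `<=` tball r by move=> t /sub; rewrite /tball/= => /le_trans; apply.
have mb := measurable_box c d; have me := @measurable_tball R n r.
have mf : measurable_fun (tball r) (fun t => (f (vec t))%:E).
  by apply: measurable_funTS; apply/measurable_EFinP; exact: measurable_continuous_vec.
rewrite -lte_fin /ball_int fineK; last first.
  by apply: integrable_fin_num => //; exact: integrable_ball.
have b0 : (0 < \int[leb]_(t in box c d) (f x0 / 2)%:E)%E.
  rewrite integral_cst// [X in (_ * X)%E](lebesgue_rn_box c d0) mule_gt0// lte_fin ?divr_gt0//.
  by rewrite exprn_gt0// pmulrn_lgt0.
apply: (lt_le_trans b0).
apply: (@le_trans _ _ (\int[leb]_(t in box c d) (f (vec t))%:E)%E).
  apply: ge0_le_integral => //.
  - by move=> t _; rewrite lee_fin divr_ge0// ltW.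
  - exact: measurable_funS mf.
apply: ge0_subset_integral => // t _.
by rewrite lee_fin.
Qed.

(** In the variable [t = ln r] the weights [r^-lam ln^-nu r] become
    [e^(- lam t) t^-nu], and the radial Laplacian has constant coefficients up
    to the factor [e^(-2 t)]. *)
Definition log_mean f (t : R) : R := sphere_int f (expR t) / ball_vol R n.

Lemma log_mean_ge0 f (t : R) : (forall x, 0 <= f x) -> 0 <= log_mean f t.
Proof. by move=> f0; rewrite divr_ge0 ?sphere_int_ge0// ltW// ball_vol_gt0. Qed.

Section fixed_function.
Variable f : 'rV[R]_n -> R.
Hypotheses (C2f : C2 f) (f0 : forall x, 0 <= f x).
Let L := laplacian f.
Hypothesis L0 : forall x, 0 <= L x.

Let cL : continuous L. Proof. exact: continuous_laplacian. Qed.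
Let vol0 := ball_vol_gt0 R n.
Let nn : n%:R != 0 :> R. Proof. by rewrite pnatr_eq0 -lt0n. Qed.

Let dmean (t : R) := expR t * (ball_int L (expR t) / (n%:R * expR t ^+ n.-1)) / ball_vol R n.

Lemma is_derive_log_mean (t : R) : is_derive t 1 (log_mean f) (dmean t).
Proof.
have d1 := is_derive_sphere_int n0 C2f f0 L0 (expR_gt0 t).
have d2 := is_derive1_comp d1 (is_derive_expR t).
apply: is_derive_congr (is_deriveZ (ball_vol R n)^-1 d2) _ _.
  by move=> s; rewrite ?fctE/= /log_mean mulrC.
by rewrite /GRing.scale/= /dmean; ring.
Qed.

Lemma is_derive_log_ball (t : R) : is_derive t 1 (fun s => ball_int L (expR s))
  (expR t * (n%:R * expR t ^+ n.-1 * sphere_int L (expR t))).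
Proof.
have d1 := is_derive_ball_int cL L0 (expR_gt0 t).
apply: is_derive_congr (is_derive1_comp d1 (is_derive_expR t)) _ _ => //.
by rewrite mulrC.
Qed.

Lemma MVT_ge (F dF : R -> R) (s s' m : R) : s <= s' ->
  (forall x : R, is_derive x 1 F (dF x)) -> (forall x, s <= x <= s' -> m <= dF x) ->
  F s + m * (s' - s) <= F s'.
Proof.
move=> ss' dF_ H; have cF : continuous F.
  by move=> x; apply: differentiable_continuous; apply/derivable1_diffP; have [] := dF_ x.
have [x xs E] := @MVT_segment R F dF s s' ss' (fun x _ => dF_ x) (continuous_subspaceT cF).
rewrite -lerBrDl E ler_wpM2r ?subr_ge0//; apply: H.
by move: xs; rewrite in_itv.
Qed.

Lemma log_ball_mono (s s' : R) : s <= s' -> ball_int L (expR s) <= ball_int L (expR s').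
Proof.
move=> ss'; have := @MVT_ge (fun s => ball_int L (expR s)) _ s s' 0 ss' is_derive_log_ball.
rewrite mul0r addr0; apply=> x _.
by rewrite !mulr_ge0 ?expR_ge0 ?exprn_ge0 ?expR_ge0 ?sphere_int_ge0.
Qed.

Lemma log_mean_mono (s s' : R) : s <= s' -> log_mean f s <= log_mean f s'.
Proof.
move=> ss'; have := MVT_ge ss' is_derive_log_mean; rewrite -[leLHS]addr0 => H.
have := H 0; rewrite mul0r; apply=> x _.
by rewrite /dmean divr_ge0 ?(ltW vol0)// mulr_ge0 ?expR_ge0// divr_ge0 ?ball_int_ge0.
Qed.

(** A quadratic lower bound for the growth of the logarithmic mean over a short
    step, from two applications of the mean value theorem: the flux grows
    linearly over the first half of the step, the mean over the second half. *)
Lemma log_mean_step (t h m : R) : 0 < h -> h <= 1 -> 0 <= m ->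
  (forall s, t <= s <= t + h -> m <= expR s ^+ 2 * log_mean L s) ->
  log_mean f t + expR (- n%:R) / 4 * h ^+ 2 * m <= log_mean f (t + h).
Proof.
move=> h0 h1 m0 Hm.
pose t2 := t + h / 2.
have tt2 : t <= t2 by rewrite /t2; lra.
have t2h : t2 <= t + h by rewrite /t2; lra.
have nR : 0 < n%:R :> R by rewrite ltr0n.
have n1E x : expR x ^+ n.-1 = expR x * expR x ^+ (n - 2).
  by rewrite -exprS; congr (_ ^+ _); case: (n) n2 => [|[|k]] //= _; rewrite subn2.
have flux : n%:R * ball_vol R n * expR t ^+ (n - 2) * m * (h / 2) <= ball_int L (expR t2).
  have := @MVT_ge (fun s => ball_int L (expR s)) _ t t2
    (n%:R * ball_vol R n * expR t ^+ (n - 2) * m) tt2 is_derive_log_ball.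
  have -> : t2 - t = h / 2 by rewrite /t2; field.
  move=> /(_ _)/wrap[x /andP[tx xt2]|].
    have := Hm x; rewrite tx (le_trans xt2)// => /(_ isT) mx.
    rewrite (_ : expR x * _ = n%:R * ball_vol R n * expR x ^+ (n - 2) * (expR x ^+ 2 * log_mean L x)); last first.
      by rewrite n1E /log_mean; field; rewrite gt_eqF.
    apply: ler_pM => //.
      by rewrite !mulr_ge0 ?exprn_ge0 ?expR_ge0 ?(ltW vol0).
    rewrite ler_wpM2l ?mulr_ge0 ?(ltW vol0)//.
    by rewrite lerXn2r ?nnegrE ?expR_ge0// ler_expR.
  by apply: le_trans; rewrite lerDr ball_int_ge0.
apply: le_trans (_ : log_mean f t2 + expR (- n%:R) / 2 * h * m * (t + h - t2) <= _).
  rewrite (_ : t + h - t2 = h / 2); last by rewrite /t2; field.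
  have := log_mean_mono tt2.
  rewrite -(lerD2r (expR (- n%:R) / 4 * h ^+ 2 * m)) => /le_trans; apply.
  by rewrite le_eqVlt; apply/orP; left; apply/eqP; field.
apply: (MVT_ge t2h is_derive_log_mean) => x /andP[t2x xth].
have ex0 : 0 < expR x ^+ (n - 2) by rewrite exprn_gt0 ?expR_gt0.
have -> : dmean x = ball_int L (expR x) / (n%:R * ball_vol R n * expR x ^+ (n - 2)).
  by rewrite /dmean n1E; field; rewrite nn !gt_eqF ?expR_gt0.
have den0 := mulr_gt0 (mulr_gt0 nR vol0) ex0.
rewrite (ler_pdivlMr _ _ den0).
apply: le_trans (log_ball_mono t2x); apply: le_trans flux.
have -> : expR (- n%:R) / 2 * h * m * (n%:R * ball_vol R n * expR x ^+ (n - 2)) =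
  (n%:R * ball_vol R n * m * (h / 2)) * (expR (- n%:R) * expR x ^+ (n - 2)) by ring.
have -> : n%:R * ball_vol R n * expR t ^+ (n - 2) * m * (h / 2) =
  (n%:R * ball_vol R n * m * (h / 2)) * expR t ^+ (n - 2) by ring.
apply: ler_wpM2l; first by rewrite !mulr_ge0 ?(ltW vol0) ?invr_ge0// ltW.
rewrite -!expRM_natl -expRD ler_expR.
have k0 : 0 <= (n - 2)%:R :> R by [].
have kn : (n - 2)%:R <= n%:R :> R by rewrite ler_nat leq_subr.
nra.
Qed.

End fixed_function.
End means_growth.

(** * Solutions of the system *)

Section solution.
Variables (R : realType) (n : nat).
Hypothesis n2 : (2 <= n)%N.
Implicit Types (p u v : 'rV[R]_n -> R).

(** [log_mean_step] with the Laplacian bounded below by [tilde_mul_mean_le]. On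
    a step of length at most 1 the weights vary by bounded factors, which
    enter the constant [d]. *)
Lemma log_mean_growth (a lam nu K r0 T : R) p u v : 1 <= a -> 0 < K -> 1 < r0 ->
  1 <= T -> ln r0 <= T -> continuous p -> (forall x, 0 <= p x) ->
  C2 u -> (forall x, 0 <= u x) -> continuous v -> (forall x, 0 <= v x) ->
  (forall x, laplacian u x = p x * v x `^ a) ->
  (forall s s', s <= s' -> log_mean v s <= log_mean v s') ->
  (forall r, r0 <= r -> K / (r `^ lam * ln r `^ nu) <= tilde a p r) ->
  exists2 c, 0 < c & forall t h, T <= t -> 0 < h -> h <= 1 ->
    log_mean u t + c * (expR ((2 - lam) * t) * t `^ (- nu)) * h ^+ 2 * log_mean v t `^ a
      <= log_mean u (t + h).
Proof.
move=> a1 K0 r01 T1 Tr cp p0 C2u u0 cv v0 Lu vmono hp.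
have n0 : (0 < n)%N by exact: leq_trans n2.
have a0 : 0 < a by exact: lt_le_trans a1.
have LE : laplacian u = fun x => p x * v x `^ a by apply/funext.
have L0 x : 0 <= laplacian u x by rewrite Lu mulr_ge0// powR_ge0.
have cL : continuous (fun x => p x * v x `^ a) by rewrite -LE; exact: continuous_laplacian.
pose q := 2 - lam.
pose d := K * expR (- `|q|) * 2 `^ (- `|- nu|).
have d0 : 0 < d by rewrite !mulr_gt0 ?expR_gt0 ?powR_gt0.
exists (expR (- n%:R) / 4 * d); first by rewrite mulr_gt0// divr_gt0 ?expR_gt0.
move=> t h Tt h0 h1; pose m := d * (expR (q * t) * t `^ (- nu)) * log_mean v t `^ a.
have m0 : 0 <= m by rewrite !mulr_ge0 ?expR_ge0 ?powR_ge0// ltW.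
have t1 : 1 <= t by exact: le_trans Tt.
have t0 : 0 < t by exact: lt_le_trans t1.
apply: le_trans (log_mean_step n2 C2u u0 L0 h0 h1 m0 _); last first.
  move=> s /andP[ts sh]; have s0 : 0 < s by exact: lt_le_trans ts.
  have sr : r0 <= expR s.
    have r00 : 0 < r0 by exact: lt_trans r01.
    by rewrite -(lnK r00) ler_expR (le_trans Tr)// (le_trans Tt).
  have := tilde_mul_mean_le n0 a1 (expR_gt0 s) cp cv cL p0 v0.
  rewrite -LE -/(log_mean v s) -/(log_mean (laplacian u) s) => H1.
  have e2 : 0 <= expR s ^+ 2 by exact: sqr_ge0.
  apply: le_trans (ler_wpM2l e2 H1); rewrite mulrA.
  have vs : log_mean v t `^ a <= log_mean v s `^ a.
    apply: ge0_ler_powR; [exact: ltW|exact: log_mean_ge0|exact: log_mean_ge0|].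
    exact: vmono.
  have X : d * (expR (q * t) * t `^ (- nu)) <= expR s ^+ 2 * tilde a p (expR s).
    apply: le_trans (ler_wpM2l e2 (hp _ sr)); rewrite expRK.
    have -> : expR s `^ lam = expR (lam * s).
      by rewrite /powR gt_eqF ?expR_gt0// expRK.
    have -> : expR s ^+ 2 * (K / (expR (lam * s) * s `^ nu)) =
        K * (expR (q * s) * s `^ (- nu)).
      have -> : expR (q * s) = expR s ^+ 2 / expR (lam * s).
        rewrite /q mulrBl expRD expRN; congr (_ / _).
        by rewrite -expRM_natl.
      by rewrite powRN; field; rewrite !gt_eqF ?expR_gt0 ?powR_gt0.
    rewrite /d -!mulrA ler_wpM2l ?(ltW K0)//.
    have -> : expR (- `|q|) * (2 `^ (- `|- nu|) * (expR (q * t) * t `^ (- nu))) =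
      (expR (- `|q|) * expR (q * t)) * (2 `^ (- `|- nu|) * t `^ (- nu)) by ring.
    apply: ler_pM; [by rewrite mulr_ge0 ?expR_ge0|by rewrite mulr_ge0 ?powR_ge0| |].
      rewrite -expRD ler_expR.
      have -> : q * s = q * t + q * (s - t) by ring.
      rewrite [leLHS]addrC lerD2l lerNl.
      apply: (@le_trans _ _ `|q * (s - t)|); first by rewrite -normrN ler_norm.
      have st0 : 0 <= s - t by rewrite subr_ge0.
      rewrite normrM (ger0_norm st0) ler_piMr//.
      by rewrite lerBlDr addrC (le_trans sh)// lerD2l.
    apply: powR_ratio_ge t0 ts _.
    by rewrite (le_trans sh)// mulr_natl mulr2n lerD2l (le_trans h1).
  apply: ler_pM; [|exact: powR_ge0|exact: X|exact: vs].
  by apply: mulr_ge0; [exact: ltW|apply: mulr_ge0; [exact: expR_ge0|exact: powR_ge0]].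
rewrite le_eqVlt; apply/orP; left; apply/eqP; rewrite /m /q; ring.
Qed.

(** Eventual positivity of ball integrals, transported to spheres by
    [ball_int_le_sphere_int]. *)
Lemma log_mean_gt0_eventually u x0 (T : R) : C2 u -> (forall x, 0 <= u x) ->
  (forall x, 0 <= laplacian u x) -> 0 < u x0 ->
  exists2 t, T <= t & 0 < log_mean u t.
Proof.
move=> C2u u0 L0 ux0; have n0 : (0 < n)%N by exact: leq_trans n2.
have cu : continuous u by case: C2u => -[].
have [r0 r0P] := ball_int_gt0 cu u0 ux0.
pose t := Num.max T r0.
exists t; first by rewrite le_max lexx.
have rt : r0 <= expR t.
  apply: (@le_trans _ _ t); first by rewrite le_max lexx orbT.
  by rewrite (le_trans _ (expR_ge1Dx t))// lerDr.
have := lt_le_trans (r0P _ rt) (ball_int_le_sphere_int n0 C2u u0 L0 (expR_gt0 t)).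
rewrite pmulr_rgt0 ?exprn_gt0 ?expR_gt0// => ?.
by rewrite /log_mean divr_gt0// ball_vol_gt0.
Qed.

(** Once the mean of [v] vanishes, the growth inequality for [v] forces that of
    [u] to vanish too. The statement covers three of the six conditions; the
    others follow by exchanging the two equations. *)
Lemma trivial_of_growth (a b k l nu xi T c1 c2 : R) u v :
  1 <= a -> 1 <= b -> 1 < a * b -> 1 <= T -> 0 < c1 -> 0 < c2 ->
  C2 u -> C2 v -> (forall x, 0 <= u x) -> (forall x, 0 <= v x) ->
  (forall x, 0 <= laplacian u x) -> (forall x, 0 <= laplacian v x) ->
  (forall t h, T <= t -> 0 < h -> h <= 1 ->
    log_mean u t + c1 * (expR (k * t) * t `^ (- nu)) * h ^+ 2 * log_mean v t `^ a
      <= log_mean u (t + h)) ->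
  (forall t h, T <= t -> 0 < h -> h <= 1 ->
    log_mean v t + c2 * (expR (l * t) * t `^ (- xi)) * h ^+ 2 * log_mean u t `^ b
      <= log_mean v (t + h)) ->
  [\/ 0 < l + b * k, l + b * k = 0 /\ 0 < 1 - xi - b * nu |
      [/\ k = 0, l = 0 & 0 < 1 - xi + b * (1 - nu)]] ->
  forall x, u x = 0 /\ v x = 0.
Proof.
move=> a1 b1 ab1 T1 c10 c20 C2u C2v u0 v0 Lu0 Lv0 Hu Hv cond.
pose c := Num.min c1 c2; have c0 : 0 < c by rewrite lt_min c10.
have b0 : 0 < b by exact: lt_le_trans b1.
have U0 t : 0 <= log_mean u t by exact: log_mean_ge0.
have V0 t : 0 <= log_mean v t by exact: log_mean_ge0.
have Um (s s' : R) : T <= s -> s <= s' -> log_mean u s <= log_mean u s'.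
  by move=> _; exact: log_mean_mono.
have Vm (s s' : R) : T <= s -> s <= s' -> log_mean v s <= log_mean v s'.
  by move=> _; exact: log_mean_mono.
have weaken (c' x y : R) t h k' nu' : c <= c' -> 0 <= y ->
    x + c * (expR (k' * t) * t `^ (- nu')) * h ^+ 2 * y <=
    x + c' * (expR (k' * t) * t `^ (- nu')) * h ^+ 2 * y.
  move=> cc y0; rewrite lerD2l ler_wpM2r// ler_wpM2r ?sqr_ge0// ler_wpM2r//.
  by rewrite mulr_ge0 ?expR_ge0 ?powR_ge0.
have HU t h : T <= t -> 0 < h -> h <= 1 ->
    log_mean u t + c * (expR (k * t) * t `^ (- nu)) * h ^+ 2 * log_mean v t `^ a
      <= log_mean u (t + h).
  move=> Tt h0 h1; apply: le_trans (Hu t h Tt h0 h1).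
  by apply: weaken; rewrite ?powR_ge0// ge_min lexx.
have HV t h : T <= t -> 0 < h -> h <= 1 ->
    log_mean v t + c * (expR (l * t) * t `^ (- xi)) * h ^+ 2 * log_mean u t `^ b
      <= log_mean v (t + h).
  move=> Tt h0 h1; apply: le_trans (Hv t h Tt h0 h1).
  by apply: weaken; rewrite ?powR_ge0// ge_min lexx orbT.
have Vz : forall t, T <= t -> log_mean v t = 0.
  case: cond => [th|[th om]|[k0 l0 sg]].
  - exact: (vanish_supercritical b1 ab1 c0 T1 U0 V0 Vm HU HV th).
  - have om1 : xi + b * nu < 1 by lra.
    exact: (vanish_critical b1 ab1 c0 T1 U0 V0 Vm HU HV th om1).
  - exact: (vanish_logarithmic a1 b1 ab1 c0 T1 U0 V0 Um Vm HU HV k0 l0 sg).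
have Uz t : T <= t -> log_mean u t = 0.
  move=> Tt; have t0 : 0 < t by rewrite (lt_le_trans ltr01)// (le_trans T1).
  have := HV t 1 Tt ltr01 (lexx _).
  rewrite !Vz ?(le_trans Tt) ?lerDl// add0r expr1n mulr1 => H.
  apply/eqP; apply: contraT => Un.
  have Ut : 0 < log_mean u t by rewrite lt_neqAle eq_sym Un U0.
  by move: H; rewrite leNgt !mulr_gt0 ?expR_gt0 ?powR_gt0.
move=> x; split; apply/eqP; apply: contraT => nz.
- have ux : 0 < u x by rewrite lt_neqAle eq_sym nz u0.
  have [t Tt] := log_mean_gt0_eventually T C2u u0 Lu0 ux.
  by rewrite Uz// ltxx.
- have vx : 0 < v x by rewrite lt_neqAle eq_sym nz v0.
  have [t Tt] := log_mean_gt0_eventually T C2v v0 Lv0 vx.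
  by rewrite Vz// ltxx.
Qed.

End solution.

Theorem theorem1p1 (R : realType) (N : nat) (hN : (3 <= N)%N)
  (alpha beta : R) (halpha : 1 <= alpha) (hbeta : 1 <= beta)
  (halphabeta : 1 < alpha * beta)
  (p q : 'rV[R]_N -> R) (hpcont : continuous p) (hqcont : continuous q)
  (hp0 : forall x, 0 <= p x) (hq0 : forall x, 0 <= q x)
  (L1 L2 r0 lambda nu mu xi : R)
  (hL1 : 0 < L1) (hL2 : 0 < L2) (hr0 : 1 < r0)
  (hp : forall r, r0 <= r ->
     L1 / (r `^ lambda * ln r `^ nu) <= tilde alpha p r)
  (hq : forall r, r0 <= r ->
     L2 / (r `^ mu * ln r `^ xi) <= tilde beta q r)
  (hcond :
     0 < 2 - mu + beta * (2 - lambda) \/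
     0 < 2 - lambda + alpha * (2 - mu) \/
     [/\ 2 - mu + beta * (2 - lambda) = 0, lambda < 2 &
         0 < 1 - xi - beta * nu] \/
     [/\ 2 - lambda + alpha * (2 - mu) = 0, mu < 2 &
         0 < 1 - nu - alpha * xi] \/
     [/\ lambda = 2, mu = 2 & 0 < 1 - xi + beta * (1 - nu)] \/
     [/\ lambda = 2, mu = 2 & 0 < 1 - nu + alpha * (1 - xi)]) :
  ~ exists u v : 'rV[R]_N -> R,
      [/\ entire_solution alpha beta p q u v,
          nonneg_pair u v & nontrivial_pair u v].
Proof.
move=> [u [v [[C2u C2v Lu Lv] [u0 v0] nontriv]]]; apply: nontriv.
have n2 : (2 <= N)%N by exact: leq_trans hN.
have n0 : (0 < N)%N by exact: leq_trans n2.
have cu : continuous u by case: C2u => -[].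
have cv : continuous v by case: C2v => -[].
have Lu0 x : 0 <= laplacian u x by rewrite Lu mulr_ge0// powR_ge0.
have Lv0 x : 0 <= laplacian v x by rewrite Lv mulr_ge0// powR_ge0.
pose T := Num.max 1 (ln r0).
have T1 : 1 <= T by rewrite le_max lexx.
have Tr : ln r0 <= T by rewrite le_max lexx orbT.
have [c1 c10 Hu] := log_mean_growth n2 halpha hL1 hr0 T1 Tr hpcont hp0 C2u u0
  cv v0 Lu (log_mean_mono n2 C2v v0 Lv0) hp.
have [c2 c20 Hv] := log_mean_growth n2 hbeta hL2 hr0 T1 Tr hqcont hq0 C2v v0
  cu u0 Lv (log_mean_mono n2 C2u u0 Lu0) hq.
have forward := trivial_of_growth n2 halpha hbeta halphabeta T1 c10 c20
  C2u C2v u0 v0 Lu0 Lv0 Hu Hv.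
have hba : 1 < beta * alpha by rewrite mulrC.
have backward := trivial_of_growth n2 hbeta halpha hba T1 c20 c10
  C2v C2u v0 u0 Lv0 Lu0 Hv Hu.
case: hcond => [c|[c|[[c _ d]|[[c _ d]|[[lE mE d]|[lE mE d]]]]]].
- by apply: forward; apply: Or31.
- by move=> x; apply/and_comm; apply: backward; apply: Or31.
- by apply: forward; apply: Or32.
- by move=> x; apply/and_comm; apply: backward; apply: Or32.
- by apply: forward; apply: Or33; split=> //; rewrite ?lE ?mE subrr.
- by move=> x; apply/and_comm; apply: backward; apply: Or33; split=> //;
    rewrite ?lE ?mE subrr.
Qed.
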